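(* Let $G$ be a finite non-solvable group. If the proper enhanced power graph $\mathcal{E}^{**}(G)$ is claw-free, then the quotient group $G/\mathrm{Cyc}(G)$ is almost simple.
   Context: For a finite group $G$, the enhanced power graph $\mathcal{E}(G)$ is the graph with vertex set $G$ in which two distinct vertices $u,v$ are adjacent if and only if $\langle u,v\rangle$ is cyclic. A vertex is dominating if it is adjacent to all other vertices. The proper enhanced power graph $\mathcal{E}^{**}(G)$ is the subgraph of $\mathcal{E}(G)$ induced on the non-dominating vertices. The cyclicizer $\mathrm{Cyc}(G)=\{x\in G\mid \langle x,y\rangle \text{ is cyclic for every } y\in G\}$ is the set of dominating vertices of $\mathcal{E}(G)$; it is a cyclic subgroup of $Z(G)$. A graph is claw-free if it has no induced subgraph isomorphic to $K_{1,3}$. A group $H$ is almost simple if, up to isomorphism, $S\leq H\leq\operatorname{Aut}(S)$ for some non-abelian simple group $S$ (identified with its group of inner automorphisms). *)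

(* Defs.v *)
From mathcomp Require Import all_boot all_fingroup all_solvable.

Set Implicit Arguments.
Unset Strict Implicit.
Unset Printing Implicit Defensive.

Import GroupScope.

(* A finite graph is given by a vertex set V : {set T} and an adjacency
   relation e : rel T; only the restriction of e to V matters, so that the
   subgraph induced on W \subset V is the pair (W, e).                        *)
Section Graphs.

Variables (T : finType) (V : {set T}) (e : rel T).

Definition dominating : {set T} :=
  [set u in V | [forall v in V, (v != u) ==> e u v]].

Definition has_induced (U : finType) (k : rel U) : Prop :=
  exists f : U -> T,
    [/\ injective f, forall a, f a \in V & forall a b, e (f a) (f b) = k a b].

End Graphs.

Definition complete_bipartite (m n : nat) : rel ('I_m + 'I_n)%type :=
  fun a b => match a, b with
             | inl _, inr _ | inr _, inl _ => true
             | _, _ => false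
             end.

Definition claw_free (T : finType) (V : {set T}) (e : rel T) : Prop :=
  ~ has_induced V e (@complete_bipartite 1 3).

Section EnhancedPowerGraph.

Variable gT : finGroupType.
Implicit Types (G : {group gT}) (u v : gT).

Definition enhanced_adj : rel gT :=
  fun u v => (u != v) && cyclic <<[set u; v]>>.

Definition proper_vertices (A : {set gT}) : {set gT} :=
  A :\: dominating A enhanced_adj.

Definition proper_enhanced_claw_free (A : {set gT}) : Prop :=
  claw_free (proper_vertices A) enhanced_adj.

Definition cyclicizer (A : {set gT}) : {set gT} :=
  [set x in A | [forall y in A, cyclic <<[set x; y]>>]].

Lemma cyclicizerE A : cyclicizer A = dominating A enhanced_adj.
Proof.
apply/setP=> x; rewrite !inE; case Ax: (x \in A) => //=.
apply/forall_inP/forall_inP=> cx y Ay.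
  by apply/implyP=> nyx; rewrite /enhanced_adj eq_sym nyx cx.
have [->|nyx] := eqVneq y x; first by rewrite setUid -/(cycle x) cycle_cyclic.
by have /implyP/(_ nyx)/andP[] := cx y Ay.
Qed.

Lemma cyclicizer_group_set G : group_set (cyclicizer G).
Proof.
apply/group_setP; split=> [|x y].
  rewrite inE group1 /=; apply/forall_inP=> y _.
  apply: cyclicS (cycle_cyclic y).
  by rewrite gen_subG subUset !sub1set group1 cycle_id.
rewrite !inE => /andP[Gx /forall_inP cx] /andP[Gy /forall_inP cy].
rewrite groupM //=; apply/forall_inP=> z Gz.
have /cyclicP[w Dw] := cx z Gz.
have xw : x \in <[w]> by rewrite -Dw mem_gen // !inE eqxx.
have zw : z \in <[w]> by rewrite -Dw mem_gen // !inE eqxx orbT.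
have Gw : w \in G.
  have: <[w]> \subset G by rewrite -Dw gen_subG subUset !sub1set Gx Gz.
  by rewrite cycle_subG.
apply: cyclicS (cy w Gw).
have sw : <[w]> \subset <<[set y; w]>>.
  by rewrite cycle_subG mem_gen // !inE eqxx orbT.
have yK : y \in <<[set y; w]>> by rewrite mem_gen // !inE eqxx.
by rewrite gen_subG subUset !sub1set groupM ?(subsetP sw z zw) ?(subsetP sw x xw).
Qed.

Canonical cyclicizer_group G := Group (cyclicizer_group_set G).

Lemma cyclicizer_sub_center G : cyclicizer G \subset 'Z(G).
Proof.
apply/subsetP=> x; rewrite !inE => /andP[Gx /forall_inP cx].
rewrite Gx /=; apply/centP=> y Gy.
have ab := cyclic_abelian (cx y Gy).
by apply: (centsP ab); rewrite mem_gen // !inE eqxx ?orbT.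
Qed.

Lemma cyclicizer_normal G : cyclicizer G <| G.
Proof. exact: sub_center_normal (cyclicizer_sub_center G). Qed.

End EnhancedPowerGraph.

(* conj_aut S @* S is Inn(S), as a subgroup of Aut S : {group {perm sT}}. *)
Definition almost_simple (gT : finGroupType) (H : {set gT}) : Prop :=
  exists (sT : finGroupType) (S : {group sT}) (A : {group {perm sT}}),
    [/\ simple S, ~~ abelian S, conj_aut S @* S \subset A, A \subset Aut S
      & H \isog A].

(* Main.v *)
Require Import Defs.
From mathcomp Require Import all_boot all_fingroup all_solvable.
From mathcomp Require Import ssralg integral_char.

Set Implicit Arguments.
Unset Strict Implicit.
Unset Printing Implicit Defensive.

Import GroupScope FiniteModule.

(** Put Z = Cyc(G). Cyclic subgroups of G/Z lift to cyclic subgroups of G, so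
    the hypothesis passes to G/Z in the form: if u <> 1 and <u,a>, <u,b>, <u,c>
    are cyclic, then so is one of <a,b>, <a,c>, <b,c>. Replace G by G/Z.

    If u <> 1 is a p-element, this forces C_G(u) to be an extension of a cyclic
    p'-group by a p-group; thus all C_G(u) with u <> 1 are solvable. Hence a
    nonabelian minimal normal subgroup N of G is simple with C_G(N) = 1, and G
    is almost simple.

    It remains to exclude a normal elementary abelian p-subgroup W <> 1 of a
    nonsolvable G. Nontrivial p'-elements act on W without fixed points, so
    Sylow q-subgroups for q <> p have rank 1. If p is odd, an involution would
    invert W and Frattini's argument would make G solvable; claws x, xv, xv^2
    show that p-elements have order p, hence that norms of p-elements vanish on
    W, hence that a p-element normalizing a subgroup of prime order q <> p
    centralizes it. Burnside's transfer theorem at the smallest prime other than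
    p then gives a normal complement, and G is solvable by induction. If p = 2,
    either the 2-elements act trivially on W and the same induction applies, or
    the square roots in tW of elements of W, where t acts as an involution,
    bound |W| by 16; then G/C_G(W) has cyclic Sylow subgroups, or |G| has at
    most two prime divisors. *)

(** * Pairs generating a cyclic subgroup *)

Section CyclicPairs.

Variable gT : finGroupType.
Implicit Types (x y z u : gT) (G H X : {group gT}).

Definition cyclic_pair x y := cyclic <<[set x; y]>>.

Lemma cyclic_pairC x y : cyclic_pair x y = cyclic_pair y x.
Proof. by rewrite /cyclic_pair setUC. Qed.

Lemma cyclic_pairP x y :
  reflect (exists2 z, z \in <<[set x; y]>> & (x \in <[z]>) && (y \in <[z]>))
          (cyclic_pair x y).
Proof.
rewrite /cyclic_pair; apply: (iffP cyclicP) => [[z defZ] | [z Xz /andP[xz yz]]].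
  by exists z; rewrite ?defZ ?cycle_id //= -defZ !mem_gen // !inE eqxx ?orbT.
exists z; apply/eqP; rewrite eqEsubset gen_subG cycle_subG Xz andbT.
by rewrite subUset !sub1set xz.
Qed.

Lemma mem_cyclic_pair X x y : cyclic X -> x \in X -> y \in X -> cyclic_pair x y.
Proof.
by move=> cX Xx Xy; apply: cyclicS cX; rewrite gen_subG subUset !sub1set Xx.
Qed.

Lemma cyclic_pair_cycle x y : y \in <[x]> -> cyclic_pair x y.
Proof. exact: mem_cyclic_pair (cycle_cyclic x) (cycle_id x). Qed.

Lemma coprime_cyclic_pair x y :
  commute x y -> coprime #[x] #[y] -> cyclic_pair x y.
Proof.
move=> cxy co; have eqM := cycleM cxy co.
apply: (@mem_cyclic_pair <[x * y]>); rewrite ?cycle_cyclic //= eqM.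
  by rewrite -[x in x \in _]mulg1 mem_mulg ?cycle_id ?group1.
by rewrite -[y in y \in _]mul1g mem_mulg ?cycle_id ?group1.
Qed.

Lemma cyclic_pair_eq_cycle x y :
  #[x] = #[y] -> cyclic_pair x y -> <[x]> = <[y]>.
Proof.
move=> oxy /cyclic_pairP[z _ /andP[xz yz]]; apply/eqP.
by rewrite (eq_subG_cyclic (cycle_cyclic z)) ?cycle_subG // -!orderE oxy.
Qed.

(* A group is not the union of two proper subgroups; apply this to two maximal
   cyclic subgroups. *)
Lemma noncyclic_three G : ~~ cyclic G ->
  exists a b c, [/\ a \in G, b \in G & c \in G] /\
    [/\ ~~ cyclic_pair a b, ~~ cyclic_pair a c & ~~ cyclic_pair b c].
Proof.
move=> ncG.
have maxcyc x : x \in G -> exists2 a, a \in G &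
    x \in <[a]> /\ forall y, cyclic_pair a y -> y \in G -> y \in <[a]>.
  move=> Gx; have xP : (x \in G) && (x \in <[x]>) by rewrite Gx cycle_id.
  case: (arg_maxnP (fun a => #[a]) (P := fun a => (a \in G) && (x \in <[a]>))
    xP).
  move=> a /andP[Ga xa] maxa; exists a => //; split=> // y.
  case/cyclic_pairP=> z az /andP[aZ yZ] Gy.
  have Gz : z \in G.
    by apply: (subsetP _ z az); rewrite gen_subG subUset !sub1set Ga.
  have saz : <[a]> \subset <[z]> by rewrite cycle_subG.
  have xz := subsetP saz x xa.
  have le_za := maxa z; rewrite Gz xz /= in le_za.
  suffices -> : <[a]> = <[z]> by [].
  by apply/eqP; rewrite eqEcard saz -!orderE; apply: le_za.
have outside a : a \in G -> exists2 b, b \in G & b \notin <[a]>.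
  move=> Ga; apply/subsetPn; apply: contra ncG => sGa.
  exact: cyclicS sGa (cycle_cyclic a).
have [a Ga [_ maxa]] := maxcyc 1 (group1 G).
have [b0 Gb0 b0a] := outside a Ga.
have [b Gb [b0b maxb]] := maxcyc b0 Gb0.
have nba : b \notin <[a]>.
  by apply: contra b0a => ba; apply: (subsetP _ b0 b0b); rewrite cycle_subG.
have ncab : ~~ cyclic_pair a b by apply: contra nba => /maxa->.
have nab : a \notin <[b]>.
  by apply: contra ncab => ab; rewrite cyclic_pairC cyclic_pair_cycle.
suffices [c Gc /norP[nca ncb]] :
    exists2 c, c \in G & ~~ ((c \in <[a]>) || (c \in <[b]>)).
  exists a, b, c; split=> //; split=> //; last by apply: contra ncb => /maxb->.
  by apply: contra nca => /maxa->.
exists (a * b); first by rewrite groupM.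
rewrite groupMl ?cycle_id // (negPf nba) /=.
by rewrite groupMr ?cycle_id.
Qed.

(* For a group with trivial cyclicizer this is claw-freeness of the proper
   enhanced power graph, for claws with centre u and leaves a, b, c. *)
Definition no_cyclic_claw G := forall u a b c,
  u \in G^# -> a \in G -> b \in G -> c \in G ->
  cyclic_pair u a -> cyclic_pair u b -> cyclic_pair u c ->
  [|| cyclic_pair a b, cyclic_pair a c | cyclic_pair b c].

(** A cyclic group has one subgroup of each prime order, and here [c] and [g^-1 * h] lie in a common
    cyclic group. *)
Lemma cyclic_pair_mem_cycle c g h :
    prime #[c] -> c \in <[g]> -> (g^-1 * h) ^+ #[c] = 1 -> cyclic_pair g h ->
  g^-1 * h \in <[c]>.
Proof.
move=> c_pr cg dc1 /cyclic_pairP[z _ /andP[gz hz]].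
have cz : c \in <[z]> by apply: (subsetP _ c cg); rewrite cycle_subG.
have dz : g^-1 * h \in <[z]> by rewrite groupM ?groupV.
have [-> | nt_d] := eqVneq (g^-1 * h) 1; first exact: group1.
suffices <- : <[g^-1 * h]> = <[c]> by apply: cycle_id.
apply/cyclic_pair_eq_cycle/(mem_cyclic_pair (cycle_cyclic z)) => //.
by apply: nt_prime_order.
Qed.

End CyclicPairs.

(** * Centralizers in groups without cyclic claws *)

Section ClawFree.

Variables (gT : finGroupType) (G : {group gT}).
Implicit Types (p q : nat) (x y z u w : gT) (H X : {group gT}).
Hypothesis clawG : no_cyclic_claw G.

(** Otherwise [noncyclic_three] supplies the leaves of a claw with centre [u]. *)
Lemma cyclic_paired_subgroup u X :
  u \in G^# -> X \subset G -> {in X, forall x, cyclic_pair u x} -> cyclic X.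
Proof.
move=> Gu sXG cuX; case: (boolP (cyclic X)) => // /noncyclic_three.
case=> a [b [c [[Xa Xb Xc] [nab nac nbc]]]].
have Gin := subsetP sXG.
have := clawG Gu (Gin a Xa) (Gin b Xb) (Gin c Xc) (cuX a Xa) (cuX b Xb) (cuX c
  Xc).
by rewrite (negPf nab) (negPf nac) (negPf nbc).
Qed.

Lemma p'group_cent1_cyclic p u X :
  u \in G^# -> p.-elt u -> X \subset 'C_G[u] -> p^'.-group X -> cyclic X.
Proof.
move=> Gu pu; rewrite subsetI => /andP[sXG cXu] p'X.
apply: (cyclic_paired_subgroup Gu) => // x Xx; apply: coprime_cyclic_pair.
  exact/esym/cent1P/(subsetP cXu).
by apply: pnat_coprime pu _; apply: mem_p_elt Xx.
Qed.

(** Sylow [q]-subgroups of the centralizer are cyclic, and generators of three distinct ones would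
    form a claw with centre [u]. So there are at most two, and the count modulo [q] leaves one. *)
Lemma Sylow_cent1_normal p q u (Q : {group gT}) :
    u \in G^# -> p.-elt u -> q != p -> q.-Sylow('C_G[u]) Q ->
  Q <| 'C_G[u].
Proof.
move=> Gu pu neq_qp sylQ; have [sQC qQ _] := and3P sylQ.
have [-> | ntQ] := eqsVneq Q 1; first exact: normal1.
have [q_pr _ _] := pgroup_pdiv qQ ntQ.
have CG x : x \in 'C_G[u] -> x \in G /\ commute u x.
  by case/setIP=> Gx /cent1P/esym.
have genS (P : {group gT}) : P \in 'Syl_q('C_G[u]) -> exists x,
    [/\ x \in G, cyclic_pair u x, P :=: <[x]> & #[x] = #|Q|].
  rewrite inE => sylP; have [sPC qP _] := and3P sylP.
  have p'P : p^'.-group P by apply: sub_in_pnat qP => r _;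
    rewrite !inE => /eqP->.
  have /cyclicP[x defP] := p'group_cent1_cyclic Gu pu sPC p'P.
  have Px : x \in P by rewrite defP cycle_id.
  have [Gx cux] := CG x (subsetP sPC x Px).
  exists x; split=> //;
    last by rewrite orderE -defP (card_Hall sylP) (card_Hall sylQ).
  exact: coprime_cyclic_pair cux (pnat_coprime pu (mem_p_elt p'P Px)).
have [le3 | gt2] := leqP #|'Syl_q('C_G[u])| 2.
  rewrite /normal sQC; apply/setIidPl; apply/eqP.
  have n1 : #|'Syl_q('C_G[u])| = 1%N.
    have := card_Syl_mod ('C_G[u])%G q_pr; move: le3.
    case: {+}#|'Syl_q('C_G[u])| => [|[|[|n]]] //; first by rewrite mod0n.
    by case: (q) (prime_gt1 q_pr) => [|[|[|m]]].
  have := card_Syl sylQ; rewrite n1 => /esym/eqP; rewrite indexg_eq1 => sCN.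
  by rewrite eqEsubset subsetIl subsetI subxx (subset_trans sCN) ?subsetIr.
have [P1 [P2 [P3 [[S1 S2 S3] [n12 n23 n31]]]]] := card_gt2P gt2.
have [x1 [Gx1 c1 d1 o1]] := genS _ S1; have [x2 [Gx2 c2 d2 o2]] := genS _ S2.
have [x3 [Gx3 c3 d3 o3]] := genS _ S3.
have /or3P[] := clawG Gu Gx1 Gx2 Gx3 c1 c2 c3 => /cyclic_pair_eq_cycle eqx.
- by case/eqP: n12; apply: val_inj; rewrite /= d1 d2 eqx ?o1.
- by case/eqP: n31; apply: val_inj; rewrite /= d1 d3 eqx ?o1.
by case/eqP: n23; apply: val_inj; rewrite /= d2 d3 eqx ?o2.
Qed.

(** For [q != p] the Sylow [q]-subgroups are normal, so the [p']-core contains all of them. *)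
Lemma p'core_cent1_Hall p u :
  u \in G^# -> p.-elt u -> p^'.-Hall('C_G[u]) 'O_p^'('C_G[u]).
Proof.
move=> Gu pu; rewrite /pHall pcore_sub pcore_pgroup pnatNK /=.
apply/pnatP=> // q q_pr qdv; rewrite !inE; apply: contraLR qdv => neq_qp.
have [Q sylQ] := Sylow_exists q ('C_G[u]).
have nsQ := Sylow_cent1_normal Gu pu neq_qp sylQ;
  have [sQC qQ q'Q] := and3P sylQ.
have sQO : Q \subset 'O_p^'('C_G[u]).
  by apply: pcore_max nsQ; apply: sub_in_pnat qQ => r _; rewrite !inE => /eqP->.
rewrite -p'natE //; apply: pnat_dvd q'Q.
by rewrite -(Lagrange_index (pcore_sub _ _) sQO) dvdn_mulr.
Qed.

Lemma p'core_cent1_cyclic p u :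
  u \in G^# -> p.-elt u -> cyclic 'O_p^'('C_G[u]).
Proof.
by move=> Gu pu; apply: (p'group_cent1_cyclic Gu pu (pcore_sub _ _)
  (pcore_pgroup _ _)).
Qed.

Lemma p_elt_cent1_solvable p u : u \in G^# -> p.-elt u -> solvable 'C_G[u].
Proof.
move=> Gu pu; rewrite (series_sol (pcore_normal p^' _)).
rewrite (abelian_sol (cyclic_abelian (p'core_cent1_cyclic Gu pu))) /=.
apply: (@pgroup_sol _ p); rewrite /pgroup card_quotient ?gFnorm //.
by have /and3P[_ _] := p'core_cent1_Hall Gu pu; rewrite pnatNK.
Qed.

(** A nontrivial primary part of [u] has a centralizer containing that of [u]. *)
Lemma cent1_solvable u : u \in G^# -> solvable 'C_G[u].
Proof.
case/setD1P=> nt_u Gu; pose p := pdiv #[u].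
have Gup : u.`_p \in G^#.
  rewrite !inE groupX // andbT -order_gt1 order_constt p_part_gt1.
  by rewrite pi_pdiv order_gt1.
apply: solvableS (p_elt_cent1_solvable Gup (p_elt_constt p u)).
apply: setIS; apply/subsetP=> y /cent1P cyu; by apply/cent1P/commuteX.
Qed.

(** [N] is a direct product of isomorphic simple groups. If there were several, each would
    centralize a nontrivial element and be solvable. As only 1 centralizes [N], conjugation embeds
    [G] in the automorphisms of [N]. *)
Lemma minnormal_nonabelian_almost_simple (N : {group gT}) :
  minnormal N G -> N \subset G -> ~~ abelian N -> almost_simple G.
Proof.
move=> minN sNG nabN; have charN := minnormal_charsimple minN.
have /andP[ntN nNG] := mingroupp minN.
have nsolN : ~~ solvable N.
  apply: contra nabN => solN.
  have [_ _ /is_abelemP[p _ abelN]] := minnormal_solvable minN (subxx N) solN.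
  exact: abelem_abelian abelN.
have cent_triv u : u \in G -> N \subset 'C[u] -> u = 1.
  move=> Gu cNu; apply/eqP; apply: contraR nsolN => nt_u.
  have Gu1 : u \in G^# by rewrite !inE nt_u.
  by apply: solvableS (cent1_solvable Gu1); rewrite subsetI sNG.
have simpleN : simple N.
  have [H [sHN simH [I sI defN]]] := charsimple_dprod charN.
  have ntI : I != set0.
    by apply: contraNneq ntN => I0; rewrite -defN I0 big_set0.
  have [f If] := set0Pn _ ntI.
  have Autf := subsetP sI f If.
  have isoH : H \isog f @: H.
    have -> : f @: H = autm Autf @* H.
      by rewrite morphimEsub //; apply: eq_imset => x; rewrite autmE.
    exact: sub_isog sHN (injm_autm Autf).
  (* One simple factor [K] is split off; [L] is the product of the others. *)
  move: defN; rewrite (bigD1 f If) /=; case/dprodP=> [[K L defK ->]].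
  rewrite defK in isoH *; move=> defN cKL tiKL.
  have ntK : K :!=: 1 by rewrite -(isog_eq1 isoH); case/simpleP: simH.
  have [L1 | ntL] := eqsVneq L 1.
    have -> : N = K by apply: val_inj; rewrite /= -defN L1 mulg1.
    by rewrite -(isog_simple isoH).
  have sKN : K \subset N by rewrite -defN mulG_subl.
  have sLN : L \subset N by rewrite -defN mulG_subr.
  have sol_cent (A B : {group gT}) : A \subset N -> B \subset N -> B :!=: 1 ->
    B \subset 'C(A) -> solvable A.
    move=> sAN sBN /trivgPn[u Bu nt_u] cAB.
    have Gu : u \in G^# by rewrite !inE nt_u (subsetP sNG) ?(subsetP sBN).
    apply: solvableS (cent1_solvable Gu);
      rewrite subsetI (subset_trans sAN) //=.
    by rewrite -cent_set1 centsC sub1set (subsetP cAB).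
  case/negP: nsolN; have nLK : K \subset 'N(L) by rewrite cents_norm // centsC.
  have nsLN : L <| N by rewrite /normal sLN -defN mulG_subG nLK normG.
  rewrite (series_sol nsLN) (sol_cent L K) // 1?centsC //= -defN quotientMidr.
  by rewrite quotient_sol // (sol_cent K L).
exists gT, N, (conj_aut N @* G)%G; split=> //.
- exact: morphimS.
- by rewrite Aut_conj_aut.
apply/isogP; exists (restrm_morphism nNG (conj_aut_morphism N)); last first.
  by rewrite /= morphim_restrm setIid.
rewrite /= ker_restrm ker_conj_aut; apply/subsetP=> u /setIP[Gu cNu];
  apply/set1P.
by rewrite (cent_triv u Gu) // -cent_set1 centsC sub1set.
Qed.

(** All three translates of [x] have [c] as a power, so they are joined to [c]; when two of them are
    joined to each other, their quotient lies in [<[c]>]. *)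
Lemma three_translates_claw x c v1 v2 v3 :
    c \in G -> prime #[c] ->
    {in [:: v1; v2; v3], forall v, x * v \in G /\ c \in <[x * v]>} ->
    {in [:: v1; v2; v3] &, forall v w, (v^-1 * w) ^+ #[c] = 1} ->
  [|| v1^-1 * v2 \in <[c]>, v1^-1 * v3 \in <[c]> | v2^-1 * v3 \in <[c]>].
Proof.
move=> Gc c_pr inG exp1.
have Gc1 : c \in G^# by rewrite !inE Gc -order_gt1 prime_gt1.
have quo v w : (x * v)^-1 * (x * w) = v^-1 * w by rewrite invMg -mulgA mulKg.
have step v w : v \in [:: v1; v2; v3] -> w \in [:: v1; v2; v3] ->
    cyclic_pair (x * v) (x * w) -> v^-1 * w \in <[c]>.
  move=> Vv Vw /(cyclic_pair_mem_cycle c_pr); rewrite quo.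
  by apply; [case: (inG v Vv) | apply: exp1].
have V1 : v1 \in [:: v1; v2; v3] by rewrite !inE eqxx.
have V2 : v2 \in [:: v1; v2; v3] by rewrite !inE eqxx orbT.
have V3 : v3 \in [:: v1; v2; v3] by rewrite !inE eqxx !orbT.
have [G1 c1] := inG v1 V1; have [G2 c2] := inG v2 V2; have [G3 c3] := inG v3 V3.
have pairC v : c \in <[v]> -> cyclic_pair c v.
  by move=> cv; rewrite cyclic_pairC cyclic_pair_cycle.
have := clawG Gc1 G1 G2 G3 (pairC _ c1) (pairC _ c2) (pairC _ c3).
case/or3P=> cp; apply/or3P.
- exact: Or31 (step _ _ V1 V2 cp).
- exact: Or32 (step _ _ V1 V3 cp).
exact: Or33 (step _ _ V2 V3 cp).
Qed.

End ClawFree.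

(** * Burnside transfer and norms *)

Section BurnsideTransfer.

Variables (gT : finGroupType) (p : nat) (G P : {group gT}).
Hypotheses (sylP : p.-Sylow(G) P) (cNP : 'N_G(P) \subset 'C(P)).

Lemma abelian_central_Sylow : abelian P.
Proof.
by apply: subset_trans cNP; rewrite subsetI normG (pHall_sub sylP).
Qed.

(* Both P and P^y are Sylow in the centralizer of h^y, so y can be corrected
   there to an element normalizing P. *)
Lemma central_Sylow_fusion h y : h \in P -> y \in G -> h ^ y \in P -> h ^ y = h.
Proof.
move=> Ph Gy Phy; have abP := abelian_central_Sylow.
have cP z : z \in P -> P \subset 'C_G[z].
  move=> Pz; rewrite subsetI (pHall_sub sylP) -cent_set1.
  by apply: subset_trans (centS _); [exact: abP | rewrite sub1set].
have sCG : 'C_G[h ^ y] \subset G by apply: subsetIl.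
have sylC := pHall_subl (cP _ Phy) sCG sylP.
have sPyC : P :^ y \subset 'C_G[h ^ y].
  apply/subsetP=> _ /imsetP[z Pz ->];
    rewrite inE (groupJ (subsetP (pHall_sub sylP) z Pz) Gy) /=.
  by apply/cent1P; rewrite /commute -!conjMg (centsP abP h Ph z Pz).
have sylPy : p.-Sylow('C_G[h ^ y]) (P :^ y).
  by apply: (pHall_subl sPyC sCG); rewrite pHallJ.
have [c /setIP[Gc /cent1P cc] defP] := Sylow_trans sylPy sylC.
have Nyc : y * c \in 'N_G(P) by rewrite inE groupM //= inE conjsgM -defP.
have cych : commute (y * c) h := centP (subsetP cNP _ Nyc) h Ph.
have hyc : h ^ (y * c) = h by rewrite conjgE -cych mulKg.
by rewrite -[RHS]hyc conjgM [RHS]conjgE -cc mulKg.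
Qed.

(** Transfer into [P] raises elements of [P] to the power [#|G : P|], which is coprime to [p]. So
    its kernel meets [P] trivially, while its image is a [p]-group. *)
Lemma Burnside_normal_complement : p^'.-Hall(G) 'O_p^'(G).
Proof.
have abP := abelian_central_Sylow; have [sPG pP p'P] := and3P sylP.
have abA : abelian (idm P @* P) by rewrite morphim_idm.
pose f := transfer_morphism G abA.
have memA g : g \in P -> g \in idm P @* P by rewrite morphim_idm.
have fP g : g \in P -> f g = (fmod abA g *+ #|G : P|)%R.
  move=> Pg; have Gg := subsetP sPG g Pg.
  have trX := transversalP (rcosets_cycle_partition sPG Gg).
  (* The transfer is a product of terms [(g ^+ n) ^ x^-1] whose exponents [n] add up to the index;
     [central_Sylow_fusion] removes the conjugations. *)
  rewrite /= (transfer_cycle_expansion sPG abA Gg trX).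
  rewrite -(sum_index_rcosets_cycle sPG Gg trX) -GRing.sumrMnr.
  apply: eq_bigr => x Xx; set n := #|_ : _|.
  have Gx : x \in G by apply: (subsetP (transversal_sub trX)).
  have Pgn : g ^+ n \in P by rewrite groupX.
  have Pgx : (g ^+ n) ^ x^-1 \in P.
    by have := mulg_exp_card_rcosets P g x;
      rewrite mem_rcoset conjgE invgK mulgA.
  rewrite (central_Sylow_fusion Pgn _ Pgx) ?groupV // -fmodX //.
  exact: memA.
have tiPK : P :&: 'ker f = 1.
  apply/trivgP/subsetP=> g /setIP[Pg /mker fg1]; apply/set1P.
  have: fmod abA (g ^+ #|G : P|) = fmod abA 1.
    by rewrite fmodX ?memA // -fP // fmod1 fg1.
  move/(congr1 val); rewrite !fmodK ?memA ?groupX // => gn1.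
  have co : coprime #|P| #|G : P| by apply: pnat_coprime pP p'P.
  by rewrite -(expgK co Pg) gn1 expg1n.
have nsKG : 'ker f <| G by apply: ker_normal.
have p'K : p^'.-group ('ker f).
  have sylK := Sylow_setI_normal nsKG sylP.
  have := card_Hall sylK; rewrite /= setIC tiPK cards1 => /esym/eqP.
  by rewrite p_part_eq1 /pgroup p'natEpi.
rewrite /pHall pcore_sub pcore_pgroup pnatNK /=.
have sKO : 'ker f \subset 'O_p^'(G) by apply: pcore_max.
have pGK : p.-nat #|G : 'ker f|.
  have imT : fmod abA @* (idm P @* P) = [set: fmod_of abA].
    apply/setP=> v; rewrite inE; apply/morphimP; exists (val v);
      rewrite ?fmodP //.
    exact/esym/fmvalK.
  have pT : p.-group [set: fmod_of abA].
    by rewrite -imT; apply: morphim_pgroup; rewrite /= morphim_idm.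
  have := card_morphim f G; rewrite setIid => <-.
  exact: pgroupS (subsetT _) pT.
apply: pnat_dvd pGK.
by rewrite -(Lagrange_index (pcore_sub _ _) sKO) dvdn_mulr.
Qed.

End BurnsideTransfer.

(** * Solvability from cyclic Sylow subgroups *)

Section Solvability.

Variable p : nat.

(** The automorphism group of [<[y]>] has order [#[y] - 1], too small for a nontrivial
    [s]-subgroup. *)
Lemma pgroup_cent_prime_cycle (gT : finGroupType) (S : {group gT}) (s : nat) y :
    s.-group S -> S \subset 'N(<[y]>) -> prime #[y] -> #[y] < s ->
  S \subset 'C(<[y]>).
Proof.
move=> sS nyS y_pr lt_ys; rewrite -ker_conj_aut ker_trivg_morphim nyS /=.
apply: contraLR lt_ys => nt; rewrite -leqNgt.
have sfS : s.-group (conj_aut <[y]> @* S) by apply: morphim_pgroup.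
have ntf : conj_aut <[y]> @* S != 1 by apply: contra nt => /eqP->; apply: subxx.
have [_ sdv _] := pgroup_pdiv sfS ntf.
have := dvdn_trans sdv (cardSg (Aut_conj_aut _ S)); rewrite card_Aut_cycle.
rewrite totient_prime // => /dvdn_leq; rewrite -subn1 subn_gt0 prime_gt1 //.
by move=> /(_ isT) les; apply: leq_trans les (leq_subr _ _).
Qed.

(* Let R be a Sylow subgroup at the smallest prime r != p dividing |K|. A prime
   other than r dividing |N_K(R) : C_K(R)| is less than r, hence equals p, which
   the last hypothesis excludes; so K has a normal r-complement. *)
Lemma smallest_prime_solvable (gT : finGroupType) (K : {group gT}) :
    (forall r (R : {group gT}), prime r -> r != p -> r.-Sylow(K) R -> cyclic R)
      ->
    (forall x y, x \in K -> y \in K -> p.-elt x -> prime #[y] -> #[y] != p ->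
      x \in 'N(<[y]>) -> commute x y) ->
  solvable K.
Proof.
elim: {K}_.+1 {-2}K (ltnSn #|K|) => // n IHn K leKn cycK centK.
have [pK | npK] := boolP (p.-group K); first exact: pgroup_sol pK.
pose r := pdiv #|K|`_(p^').
have gt1 : 1 < #|K|`_p^'.
  rewrite ltn_neqAle part_gt0 andbT eq_sym; apply: contra npK => /eqP K1.
  by rewrite /pgroup -(partnC p (cardG_gt0 K)) K1 muln1 part_pnat.
have r_pr : prime r := pdiv_prime gt1.
have rdvd : r %| #|K| by rewrite (dvdn_trans (pdiv_dvd _)) ?dvdn_part.
have neq_rp : r != p.
  by have /pnatP-/(_ (part_gt0 _ _) r r_pr (pdiv_dvd _)) := part_pnat p^' #|K|.
have [R sylR] := Sylow_exists r K; have [sRK rR _] := and3P sylR.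
have cycR := cycK r R r_pr neq_rp sylR.
have ntR : R :!=: 1 by rewrite -rank_gt0 (rank_Sylow sylR) p_rank_gt0
  mem_primes r_pr cardG_gt0.
have [_ rdvR _] := pgroup_pdiv rR ntR; have [y Ry oy] := Cauchy r_pr rdvR.
(* [<[y]>] is characteristic in the cyclic group [R], so [S] acts on it. For [s = p] the commutation
   hypothesis applies; otherwise a nontrivial [S] has [r < s] by minimality of [r]. *)
have cSy (S : {group gT}) s : s != r -> s.-Sylow('N_K(R)) S -> S \subset 'C[y].
  move=> neq_sr sylS; have [sSN sS _] := and3P sylS.
  have nyS : S \subset 'N(<[y]>).
    apply: char_norm_trans (subset_trans sSN (subsetIr _ _)).
    by rewrite (sub_cyclic_char _ cycR) cycle_subG.
  have sSK : S \subset K by apply: subset_trans sSN (subsetIl _ _).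
  have [sp | neq_sp] := eqVneq s p.
    apply/subsetP=> x Sx; apply/cent1P.
    apply: centK (subsetP sSK x Sx) (subsetP sRK y Ry) _ _ _ (subsetP nyS x Sx).
    - by rewrite -sp; apply: mem_p_elt Sx.
    - by rewrite oy.
    by rewrite oy.
  rewrite -cent_cycle; have [-> | ntS] := eqsVneq S 1; first exact: sub1G.
  have [s_pr sdvS _] := pgroup_pdiv sS ntS.
  have lt_rs : r < s.
    rewrite ltn_neqAle eq_sym neq_sr pdiv_min_dvd ?prime_gt1 //.
    have := dvdn_trans sdvS (cardSg sSK); rewrite -{1}(partnC p (cardG_gt0 K)).
    by rewrite Euclid_dvdM // => /orP[] // /(pnat_dvd)/(_ (part_pnat _ _));
      rewrite pnatE // => /eqP sp; case/eqP: neq_sp.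
  by apply: pgroup_cent_prime_cycle sS nyS _ _; rewrite oy.
have cNR : 'N_K(R) \subset 'C(R).
  (* The normalizer is generated by its Sylow subgroups; each is shown to centralize [R]. *)
  have defN := Sylow_gen ('N_K(R))%G; rewrite /= in defN;
    rewrite -{1}defN gen_subG; apply/bigcupsP=> S /SylowP[s s_pr sylS].
  have [sSN sS _] := and3P sylS.
  have nRN : 'N_K(R) \subset 'N(R) by apply: subsetIr.
  have [sr | neq_sr] := eqVneq s r.
    have sylRN : r.-Sylow('N_K(R)) R by rewrite Sylow_subnorm.
    apply: subset_trans (cyclic_abelian cycR).
    rewrite (sub_normal_Hall sylRN) ?sSN // -?sr //.
    by rewrite /normal (pHall_sub sylRN).
  have coRS : coprime #|R| #|S|.
    by apply: pnat_coprime rR _; apply: sub_in_pnat sS => t _;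
      rewrite !inE => /eqP->.
  have nRS := subset_trans sSN nRN.
  have ti := coprime_abel_cent_TI nRS coRS (cyclic_abelian cycR).
  (* A nontrivial [[~: R, S]] would contain [y], the generator of the only subgroup of order [r];
     but [S] centralizes [y], against [ti]. *)
  rewrite centsC; apply/commG1P/eqP; apply: contraTT isT => nt.
  have sRSR : [~: R, S] \subset R by rewrite commg_subl.
  have yRS : y \in [~: R, S].
    have [_ rdv _] := pgroup_pdiv (pgroupS sRSR rR) nt.
    have [z RSz oz] := Cauchy r_pr rdv.
    rewrite -cycle_subG; suffices -> : <[y]> = <[z]> by rewrite cycle_subG.
    apply: cyclic_pair_eq_cycle; rewrite ?oy ?oz //.
    exact: mem_cyclic_pair cycR Ry (subsetP sRSR z RSz).
  have: y \in [~: R, S] :&: 'C(S).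
    by rewrite inE yRS -sub_cent1 (cSy S s).
  rewrite ti => /set1P y1; move: r_pr; rewrite -oy y1 order1 //.
have hallO := Burnside_normal_complement sylR cNR.
have sOK := pcore_sub r^' K.
rewrite (series_sol (pcore_normal r^' K)); apply/andP; split.
  apply: IHn.
  - rewrite ltnS in leKn; apply: leq_trans leKn; apply: proper_card;
    rewrite properEneq sOK andbT.
    apply/eqP=> eqO; have := pcore_pgroup r^' K;
      rewrite eqO => /pgroupP/(_ r r_pr rdvd).
    by rewrite !inE eqxx.
  - move=> s S s_pr neq_sp sylS; have [sSO sS _] := and3P sylS.
    have [T sylT sST] := Sylow_superset (subset_trans sSO sOK) sS.
    exact: cyclicS sST (cycK s T s_pr neq_sp sylT).
  by move=> x z Ox Oz; apply: centK; apply: (subsetP sOK).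
apply: (@pgroup_sol _ r); rewrite /pgroup card_quotient ?gFnorm //.
by have /and3P[_ _] := hallO; rewrite pnatNK.
Qed.

End Solvability.

(** * Norm sums over operators on an abelian group *)

Section NormSums.

Variables (gT : finGroupType) (W : {group gT}) (abW : abelian W).
Implicit Types (u v : fmod_of abW) (Y : {group gT}).
Local Open Scope ring_scope.

(** Acting by an element of [Y] permutes the summands, so the sum is a fixed point of [Y]. *)
Lemma norm_sum_fixed Y u :
  Y \subset 'N(W) -> ('C_W(Y) = 1)%g -> \sum_(z in Y) u ^@ z = 0.
Proof.
move=> nWY tiWY; apply: val_inj; apply/set1P;
  rewrite -[[set _]]tiWY inE fmodP /=.
apply/centP=> g Yg; have nWg := subsetP nWY g Yg.
set v := \sum_(z in Y) _; have vg : v ^@ g = v.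
  rewrite /v actr_sum [RHS](reindex_inj (mulIg g)) /=.
  apply: eq_big => [z | z Yz]; first by rewrite groupMr.
  by rewrite actrM // (subsetP nWY).
by rewrite /commute conjgC -fmvalJ // vg.
Qed.

(** Acting by [g] shifts the exponents cyclically, since [g ^+ r = 1]; so the sum is fixed by
    [g]. *)
Lemma norm_sum_expg1 g r u :
  g \in 'N(W) -> ('C_W[g] = 1)%g -> (g ^+ r = 1)%g ->
  \sum_(j < r) u ^@ (g ^+ j)%g = 0.
Proof.
move=> nWg tiWg gr; set v := \sum_(j < r) _.
apply: val_inj; apply/set1P; rewrite -[[set _]]tiWg inE fmodP /=; apply/cent1P.
suffices vg : v ^@ g = v by rewrite /commute conjgC -fmvalJ // vg.
have -> : v ^@ g = \sum_(j < r) u ^@ (g ^+ j.+1)%g.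
  by rewrite /v actr_sum; apply: eq_bigr => j _; rewrite expgSr actrM ?groupX.
case: (r) gr @v => [|n] gn v; first by rewrite /v !big_ord0.
by rewrite /v big_ord_recr big_ord_recl /= gn expg0 GRing.addrC.
Qed.

(** This translates powers of elements of the coset of [g] modulo [W] into norms on [W]. *)
Lemma expg_mul_fmod g u n : g \in 'N(W) ->
  ((g * val u) ^+ n)%g = (g ^+ n * val (\sum_(j < n) u ^@ (g ^+ j)%g))%g.
Proof.
move=> nWg; elim: n => [|n IHn]; first by rewrite !expg0 big_ord0 mulg1.
rewrite expgSr {}IHn big_ord_recl expg0 actr1.
have -> : \sum_(j < n) u ^@ (g ^+ lift ord0 j)%g
          = (\sum_(j < n) u ^@ (g ^+ j)%g) ^@ g.
  by rewrite actr_sum; apply: eq_bigr => j _; rewrite expgSr actrM ?groupX.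
rewrite GRing.addrC fmvalA fmvalJ // expgSr conjgE; by rewrite !mulgA mulgK.
Qed.

(* Sum u ^@ g ^+ j over all g in xY and j < r: for each j > 0 the powers g ^+ j
   run over the coset x^j Y and contribute 0, while j = 0 contributes |Y| copies
   of u. *)
Lemma norm_sums_coset Y x r u :
    prime r -> Y \subset 'N(W) -> x \in 'N(W) -> x \in 'N(Y) ->
    (forall v, \sum_(z in Y) v ^@ z = 0) ->
    (forall g, g \in (x *: Y)%g -> (g ^+ r = 1)%g /\
       forall v, \sum_(j < r) v ^@ (g ^+ j)%g = 0) ->
  u *+ #|Y| = 0.
Proof.
move=> r_pr nWY nWx nYx sumY sumx.
have: \sum_(g in (x *: Y)%g) \sum_(j < r) u ^@ (g ^+ j)%g = 0.
  by rewrite big1 // => g /sumx[].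
rewrite exchange_big /=.
rewrite (bigD1 (Ordinal (prime_gt0 r_pr))) //= [X in _ + X]big1 => [|j nz_j].
  rewrite GRing.addr0 (eq_bigr (fun=> u)) => [|g _];
    last by rewrite expg0 actr1.
  by rewrite GRing.sumr_const card_lcoset.
(* Here [0 < j < r] with [r] prime, so the [j]-th power can be inverted on elements with
   [g ^+ r = 1]. *)
have injX : {in (x *: Y)%g &, injective (fun g => (g ^+ j)%g)}.
  move=> g h /sumx[gr _] /sumx[hr _] /= eq_gh.
  have j_gt0 : (0 < j)%N by rewrite lt0n.
  have co : coprime j r by rewrite coprime_sym prime_coprime // gtnNdvd.
  have [a b eq_ab _] := egcdnP r j_gt0; rewrite (eqP co) in eq_ab.
  have powK (k : gT) : (k ^+ r = 1)%g -> ((k ^+ j) ^+ a = k)%g.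
    by move=> kr; rewrite -expgM mulnC eq_ab expgD mulnC expgM kr expg1n mul1g.
  by rewrite -[g]powK // eq_gh powK.
(* Every [g] in the coset agrees with [x] modulo [Y], which gives an inclusion; injectivity makes
   the cardinals equal. *)
have imX : [set (g ^+ j)%g | g in (x *: Y)%g] = (x ^+ j *: Y)%g.
  apply/eqP; rewrite eqEcard card_in_imset // !card_lcoset leqnn andbT.
  apply/subsetP=> _ /imsetP[g Yg ->]; rewrite -norm_rlcoset ?groupX //.
  rewrite -norm_rlcoset // in Yg.
  have nYg : (g \in 'N(Y))%g.
    by move: Yg; rewrite mem_rcoset => /(subsetP (normG Y));
      rewrite groupMr ?groupV.
  apply/rcoset_kercosetP; rewrite ?groupX // !morphX //.
  by congr (_ ^+ _)%g; apply/rcoset_kercosetP.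
rewrite -(big_imset (fun h => u ^@ h) injX) /= imX.
rewrite (reindex_inj (mulgI (x ^+ j)%g)) /=.
rewrite (eq_bigl (mem Y)) => [|z]; last by rewrite mem_lcoset mulKg.
rewrite -[RHS](sumY (u ^@ (x ^+ j)%g)); apply: eq_bigr => z Yz.
by rewrite actrM ?groupX // (subsetP nWY).
Qed.

End NormSums.

(** * Normal elementary abelian subgroups *)

Section AbelianNormal.

Variables (gT : finGroupType) (G W : {group gT}) (p : nat).
Hypotheses (clawG : no_cyclic_claw G) (nsolG : ~~ solvable G).
Hypotheses (p_pr : prime p) (nsWG : W <| G) (ntW : W :!=: 1) (abelW : p.-abelem
  W).

Let sWG : W \subset G := normal_sub nsWG.
Let nWG : G \subset 'N(W) := normal_norm nsWG.
Let abW : abelian W := abelem_abelian abelW.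
Let pW : p.-group W := abelem_pgroup abelW.

Let W1G w : w \in W^# -> w \in G^#.
Proof. by case/setD1P=> nt_w Ww; rewrite !inE nt_w (subsetP sWG). Qed.

Let cent_sub_cent1 w : w \in W -> 'C_G(W) \subset 'C_G[w].
Proof.
by move=> Ww; rewrite setIS // sub_cent1 (subsetP _ w Ww) // centsC.
Qed.

Lemma cent_normal_abelem_sol : solvable 'C_G(W).
Proof.
have [w Ww nt_w] := trivgPn _ ntW.
have Ww1 : w \in W^# by rewrite !inE nt_w.
exact: solvableS (cent_sub_cent1 Ww) (cent1_solvable clawG (W1G Ww1)).
Qed.

(** A cyclic [W] has abelian automorphism group, so the derived subgroup of [G] would lie in the
    solvable group ['C_G(W)]. *)
Lemma normal_abelem_noncyclic : ~~ cyclic W.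
Proof.
apply: contra nsolG => cycW.
rewrite (series_sol (der_normal 1 G)) (abelian_sol (der_abelian 0 G)) andbT.
apply: solvableS cent_normal_abelem_sol; rewrite subsetI der_sub /=.
have sG1N : G^`(1) \subset 'N(W) := subset_trans (der_sub 1 G) nWG.
rewrite -ker_conj_aut ker_trivg_morphim sG1N /= morphim_der //.
by apply/trivgP/derG1P;
  rewrite (abelianS (Aut_conj_aut _ _)) ?Aut_cyclic_abelian.
Qed.

(* If e fixes w, it lies in the p'-core of C_G(w), which W centralizes; then W
   is a p-subgroup of C_G(e), hence cyclic. *)
Lemma p'elt_fixpoint_free e :
  e \in G -> p^'.-elt e -> e != 1 -> 'C_W[e] = 1.
Proof.
move=> Ge p'e nt_e; apply/eqP; apply: contraR normal_abelem_noncyclic.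
case/trivgPn=> w /setIP[Ww cew] nt_w.
have Gw : w \in G^# by rewrite W1G // !inE nt_w.
have hallH := p'core_cent1_Hall clawG Gw (mem_p_elt pW Ww).
set H := 'O_p^'(_) in hallH *; have nsH : H <| 'C_G[w] := pcore_normal _ _.
have He : e \in H.
  by rewrite (mem_normal_Hall hallH nsH) // inE Ge cent1C.
have sWC : W \subset 'C_G[w].
  by rewrite subsetI sWG sub_cent1 (subsetP abW).
have cWH : W \subset 'C(H).
  apply/commG1P/trivgP;
    rewrite -(coprime_TIg (pnat_coprime pW (pcore_pgroup _ 'C_G[w]))).
  rewrite commg_subI // subsetI ?subxx ?(subset_trans sWC (normal_norm nsH))
    //=.
  by rewrite (subset_trans (pcore_sub _ _)) // subIset // nWG.
have Ge1 : e \in G^# by rewrite !inE nt_e.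
apply: (cyclic_paired_subgroup clawG Ge1 sWG) => x Wx.
apply: coprime_cyclic_pair; first exact/esym/(centsP cWH).
by rewrite coprime_sym; apply: pnat_coprime (mem_p_elt pW Wx) p'e.
Qed.

Lemma cent1_normal_abelem_pgroup w : w \in W^# -> p.-group 'C_G[w].
Proof.
case/setD1P=> nt_w Ww;
  apply/pgroupP=> q q_pr /(Cauchy q_pr)[e /setIP[Ge cwe] oe].
rewrite !inE; apply: contraR nt_w => neq_qp.
have nt_e : e != 1 by rewrite -order_gt1 oe prime_gt1.
have p'e : p^'.-elt e by rewrite /p_elt oe pnatE // !inE.
by rewrite -in_set1 -[[set 1]](p'elt_fixpoint_free Ge p'e nt_e) inE Ww cent1C.
Qed.

Lemma cent_normal_abelem_pgroup : p.-group 'C_G(W).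
Proof.
have [w Ww nt_w] := trivgPn _ ntW.
have Ww1 : w \in W^# by rewrite !inE nt_w.
exact: pgroupS (cent_sub_cent1 Ww) (cent1_normal_abelem_pgroup Ww1).
Qed.

(** This is what the conclusion of [norm_sums_coset] contradicts when [#|Y| = q]. *)
Lemma mulrn_coprime_fmod (q : nat) :
  q != p -> prime q -> ~ forall u : fmod_of abW, (u *+ q)%R = 0%R.
Proof.
move=> neq_qp q_pr u0; have [w Ww nt_w] := trivgPn _ ntW; case/eqP: nt_w.
have wq : w ^+ q = 1.
  by rewrite -(fmodK abW Ww) -fmvalZ u0.
apply/eqP; rewrite -order_eq1 -dvdn1 -(eqP (_ : coprime #[w] q)) ?dvdn_gcd.
  by rewrite dvdnn order_dvdn wq eqxx.
apply: pnat_coprime (mem_p_elt pW Ww) _.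
by rewrite pnatE // !inE.
Qed.

(** In an elementary abelian subgroup of order [q ^ 2] all nontrivial elements act without fixed
    points, so all norms vanish. Then [norm_sums_coset] for a subgroup [<[b]>] and an element [a]
    outside it shows that [q] annihilates [W]. *)
Lemma p'group_rank_le1 q (Q : {group gT}) :
  prime q -> q != p -> Q \subset G -> q.-group Q -> 'r_q(Q) <= 1.
Proof.
move=> q_pr neq_qp sQG qQ; rewrite leqNgt;
  apply/negP=> /p_rank_geP[E /pnElemP[sEQ abelE dimE]].
have sEG := subset_trans sEQ sQG; have nWE := subset_trans sEG nWG.
have expE g : g \in E -> g ^+ q = 1 by case/(abelemP q_pr): abelE => _; apply.
have tiE g : g \in E -> g != 1 -> 'C_W[g] = 1.
  move=> Eg; apply: p'elt_fixpoint_free; first exact: (subsetP sEG).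
  apply: sub_in_pnat (mem_p_elt (abelem_pgroup abelE) Eg) => r _.
  by rewrite !inE => /eqP->.
have oE : #|E| = (q ^ 2)%N by rewrite (card_pgroup (abelem_pgroup abelE)) dimE.
have [b Eb nt_b] : exists2 b, b \in E & b != 1.
  by apply/trivgPn; rewrite -cardG_gt1 oE -(exp1n 2) ltn_exp2r // prime_gt1.
have ob : #[b] = q := abelem_order_p abelE Eb nt_b.
have [a Ea nba] : exists2 a, a \in E & a \notin <[b]>.
  apply/subsetPn; apply/negP=> /subset_leq_card; rewrite -orderE ob oE leqNgt.
  by rewrite ltn_Pmull ?prime_gt1 ?prime_gt0.
have sbE : <[b]> \subset E by rewrite cycle_subG.
apply: (@mulrn_coprime_fmod q neq_qp q_pr) => u.
rewrite -[X in (_ *+ X)%R]ob orderE.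
apply: (@norm_sums_coset _ W abW <[b]>%G a q u q_pr).
- exact: subset_trans sbE nWE.
- exact: (subsetP nWE).
- rewrite (subsetP (cents_norm _) a Ea) //.
  by rewrite (subset_trans (abelem_abelian abelE)) // centS.
- by move=> v; rewrite norm_sum_fixed ?(subset_trans sbE nWE) //= cent_cycle
  tiE.
move=> g ag; have Eg : g \in E.
  case/lcosetP: ag => z bz ->; by rewrite groupM // (subsetP sbE).
have nt_g : g != 1.
  by apply: contraNneq nba => g1; move: ag; rewrite g1 mem_lcoset mulg1 groupV.
split=> [|v]; first exact: expE.
by apply: norm_sum_expg1; rewrite ?expE ?tiE ?(subsetP nWE).
Qed.

Lemma odd_p'group_cyclic q (Q : {group gT}) :
  prime q -> q != p -> odd q -> Q \subset G -> q.-group Q -> cyclic Q.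
Proof.
move=> q_pr neq_qp odd_q sQG qQ.
rewrite (odd_pgroup_rank1_cyclic qQ) ?(p'group_rank_le1 q_pr) //.
by rewrite (card_pgroup qQ) oddX odd_q orbT.
Qed.

Let nsCG : 'C_G(W) <| G.
Proof. by rewrite -{2}(setIidPl nWG) subcent_normal. Qed.

(** An involution [t] inverts [W], so [C <*> <[t]>] with [C = 'C_G(W)] is normal and has [<[t]>] as
    a Sylow 2-subgroup. By Frattini's argument [G] is this solvable group times the normalizer of
    [<[t]>], which centralizes [t]. *)
Lemma odd_abelem_odd_order : odd p -> odd #|G|.
Proof.
move=> odd_p; apply: contraR nsolG => even_G.
have [t Gt ot] : {t | t \in G & #[t] = 2} by apply: Cauchy; rewrite // dvdn2.
have nt_t : t != 1 by rewrite -order_gt1 ot.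
have p't : p^'.-elt t.
  by rewrite /p_elt ot pnatE // !inE; apply: contraTneq odd_p => <-.
have tiWt := p'elt_fixpoint_free Gt p't nt_t.
have nWt := subsetP nWG t Gt.
(* The product [w * w ^ t] is fixed by [t], hence trivial. *)
have inv w : w \in W -> w ^ t = w^-1.
  move=> Ww; have Wwt : w ^ t \in W by rewrite memJ_norm.
  apply/eqP; rewrite eq_sym eq_invg_mul; apply/eqP/set1P.
  rewrite -[[set _]]tiWt inE groupM //=; apply/cent1P/commgP.
  rewrite -conjg_fix conjMg -conjgM -[t * t]/(t ^+ 2) -ot expg_order conjg1.
  by rewrite (centsP abW _ Wwt _ Ww).
pose C := 'C_G(W)%G; have nCG : G \subset 'N(C) := normal_norm nsCG.
have nCt : <[t]> \subset 'N(C) by rewrite cycle_subG (subsetP nCG).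
have pC : p.-group C := cent_normal_abelem_pgroup.
have coCt : coprime #|C| #|<[t]>|.
  by rewrite -orderE ot; apply: pnat_coprime pC _; rewrite -ot.
have sCG : C \subset G := normal_sub nsCG.
have defD : C <*> <[t]> = C * <[t]> by rewrite norm_joinEr.
have sDG : C <*> <[t]> \subset G by rewrite join_subG sCG cycle_subG.
have nsDG : C <*> <[t]> <| G.
  rewrite /normal sDG; apply/subsetP=> g Gg; rewrite inE conjYg join_subG.
  rewrite (normP (subsetP nCG g Gg)) joing_subl -cycleJ cycle_subG /=.
  (* Both [t ^ g] and [t] invert [W], so they differ by an element of [C]. *)
  rewrite -[t ^ g](mulgKV t) -[t ^ g * _]invgK groupM //; last first.
    by rewrite mem_gen // inE cycle_id orbT.
  rewrite groupV mem_gen // inE; apply/orP; left.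
  rewrite inE groupV groupM ?groupV ?groupJ //=; apply/centP=> w Ww.
  have Wwg : w ^ g^-1 \in W by rewrite memJ_norm // groupV (subsetP nWG).
  apply/esym/commgP;
    rewrite -conjg_fix conjgM [t ^ g]conjgE !conjgM (inv _ Wwg).
  by rewrite conjVg conjgKV -(inv w Ww) conjgK.
have sylt : 2.-Sylow(C <*> <[t]>) <[t]>.
  rewrite /pHall joing_subr /= /pgroup -orderE ot /= -divgS ?joing_subr //=
    defD.
  rewrite TI_cardMg ?coprime_TIg // mulnK ?cardG_gt0 //.
  apply: sub_in_pnat pC => q _; rewrite !inE => /eqP->.
  by apply: contraTneq odd_p => ->.
have solC : solvable C := pgroup_sol pC.
have defG := Frattini_arg nsDG sylt.
have nsCD : C <| C <*> <[t]> by rewrite /normal joing_subl join_subG normG.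
have solD : solvable (C <*> <[t]>).
  rewrite (series_sol nsCD) solC /= defD quotientMidl.
  by rewrite quotient_sol // abelian_sol ?cycle_abelian.
have eqGD : G / (C <*> <[t]>) = 'N_G(<[t]>) / (C <*> <[t]>).
  by rewrite -[RHS](quotientMidl (C <*> <[t]>)%G) [in RHS]defG.
rewrite (series_sol nsDG) solD /= eqGD quotient_sol //.
have Gt1 : t \in G^# by rewrite !inE nt_t.
apply: solvableS (cent1_solvable clawG Gt1); rewrite setIS //.
apply/subsetP=> g; rewrite inE -cycleJ cycle_subG /= cycle2g //.
case/set2P=> [/eqP | tg]; first by rewrite conjg_eq1 (negPf nt_t).
by apply/cent1P/esym/commgP; rewrite -conjg_fix tg.
Qed.

Lemma abelem_expg v : v \in W -> v ^+ p = 1.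
Proof. by case/(abelemP p_pr): abelW => _; apply. Qed.

(** If the fixed points [A] of [x] do not all lie in [<[c]>], one outside serves as [v]. Otherwise
    [A] is cyclic, hence proper in [W], and [v] lifts a nontrivial fixed point of [x] on [W / A]. *)
Lemma second_fixpoint x c : x \in G -> p.-elt x -> c \in <[x]> ->
  exists v, [/\ v \in W, v \notin <[c]> & [~ v, x] \in 'C_W[x]].
Proof.
move=> Gx px xc; set A := 'C_W[x].
have nWx : x \in 'N(W) := subsetP nWG x Gx.
have [sAc | /subsetPn[v Av nc_v]] := boolP (A \subset <[c]>); last first.
  have [Wv /cent1P cvx] := setIP Av.
  by exists v; rewrite Wv nc_v (_ : [~ v, x] = 1) ?group1 //; apply/eqP/commgP.
have sAW : A \subset W := subsetIl _ _.
have nAx : <[x]> \subset 'N(A).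
  rewrite normsI ?cycle_subG // (subsetP (normG 'C[x])) //.
  exact/cent1P.
have nAW : W \subset 'N(A) := sub_abelian_norm abW sAW.
pose L := W <*> <[x]>.
have pL : p.-group L.
  by rewrite /L norm_joinEr ?cycle_subG // pgroupM pW.
have ntWA : W / A != 1.
  apply: contra normal_abelem_noncyclic => /eqP WA1.
  apply: cyclicS (cycle_cyclic c); apply: subset_trans sAc.
  by rewrite -quotient_sub1 // WA1.
have nsWL : W / A <| L / A.
  by rewrite quotient_normal // /normal joing_subl join_subG normG cycle_subG.
have := meet_center_nil (pgroup_nil (quotient_pgroup A pL)) nsWL ntWA.
case/trivgPn=> _ /setIP[/morphimP[v Nv Wv ->] /centerP[_ cvL]] nt_v.
have nAv : v \notin A by apply: contra nt_v => Av; rewrite /= coset_id.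
have Lx : x \in L by rewrite mem_gen // inE cycle_id orbT.
have Nx : x \in 'N(A) by rewrite -cycle_subG.
exists v; split=> //.
  apply: contra nAv => cv; rewrite inE Wv; apply/cent1P/esym.
  have /cycleP[i ->] : v \in <[x]> by apply: (subsetP _ v cv);
    rewrite cycle_subG.
  exact: commuteX.
apply: coset_idr; first by rewrite groupR.
by rewrite morphR //; apply/eqP/commgP/cvL; rewrite mem_quotient.
Qed.

(* If x^m = c has order p with p %| m, then x, xv and xv^2 have the same m-th
   power c for a suitable v, and form a claw with centre c. *)
Lemma odd_p_elt_expg x : odd p -> x \in G -> p.-elt x -> x ^+ p = 1.
Proof.
move=> odd_p Gx px; apply/eqP; apply: contraT => nt_xp.
have [[|k] ox] := p_natP px; first by rewrite -order_dvdn ox dvd1n in nt_xp.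
have k_gt0 : 0 < k.
  rewrite lt0n; apply: contra nt_xp => /eqP k0.
  by rewrite -order_dvdn ox k0 expn1.
pose m := (p ^ k)%N; pose c := x ^+ m.
have oc : #[c] = p.
  by rewrite orderXdiv ox expnS ?dvdn_mull // mulnK // expn_gt0 prime_gt0.
have [v [Wv ncv Rv]] := second_fixpoint Gx px (mem_cycle x m).
(* Expanding the power leaves [x ^+ m], [u ^+ m] and a power of [[~ u, x]] with exponent [m(m-1)/2].
   As [p] is odd and divides [m], the last two vanish. *)
have translate u : u \in W -> [~ u, x] \in 'C_W[x] -> (x * u) ^+ m = c.
  move=> Wu /setIP[WR /cent1P cRx].
  have dvd_pm : p %| m by rewrite dvdn_exp.
  have exp_m y j : y \in W -> y ^+ (m * j) = 1.
    move=> Wy; case/dvdnP: dvd_pm => i ->.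
    by rewrite -mulnA mulnCA expgM abelem_expg ?expg1n.
  rewrite expMg_Rmul //; last by rewrite /commute (centsP abW).
  rewrite -{2}[m]muln1 exp_m // mulg1 bin2odd ?exp_m ?mulg1 //.
  by rewrite oddX odd_p orbT.
have WR : [~ v, x] \in W by case/setIP: Rv.
have Rv2 : [~ v ^+ 2, x] \in 'C_W[x].
  by rewrite commXg ?groupX //; apply: (centsP abW).
have R1 : [~ 1, x] \in 'C_W[x] by rewrite comm1g group1.
have Gc : c \in G by rewrite groupX.
have VW : {in [:: 1; v; v ^+ 2], forall u, u \in W /\ [~ u, x] \in 'C_W[x]}.
  move=> u Vu; have {Vu}: [|| u == 1, u == v | u == v ^+ 2] by rewrite !inE in
    Vu.
  by case/or3P=> /eqP->; split=> //; rewrite ?group1 ?groupX.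
have inG : {in [:: 1; v; v ^+ 2], forall u, x * u \in G /\ c \in <[x * u]>}.
  move=> u /VW[Wu Ru]; rewrite (groupM Gx (subsetP sWG u Wu)); split=> //.
  by rewrite -(translate u Wu Ru) mem_cycle.
have exp1 : {in [:: 1; v; v ^+ 2] &, forall u w, (u^-1 * w) ^+ #[c] = 1}.
  by move=> u w /VW[Wu _] /VW[Ww _]; rewrite oc abelem_expg ?groupM ?groupV.
have c_pr : prime #[c] by rewrite oc.
have := three_translates_claw clawG Gc c_pr inG exp1.
rewrite invg1 !mul1g mulKg (negPf ncv) orbF /= => cv2; case/negP: ncv.
(* The remaining case puts [v ^+ 2] in [<[c]>]; since [v ^+ p = 1] with [p] odd, [v] is a power of
   [v ^+ 2]. *)
have -> : v = (v ^+ 2) ^+ p.+1./2.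
  by rewrite -expgM mul2n halfK /= odd_p /= subn0 expgS abelem_expg ?mulg1.
by rewrite groupX.
Qed.

(** If [x] and [y] did not commute, all elements of [x *: <[y]>] would have [p]-th power 1 and
    vanishing norms, and [norm_sums_coset] would make [#[y]] annihilate [W]. *)
Lemma odd_p_elt_cent_prime x y :
    odd p -> x \in G -> y \in G -> p.-elt x -> prime #[y] -> #[y] != p ->
  x \in 'N(<[y]>) -> commute x y.
Proof.
move=> odd_p Gx Gy px q_pr neq_qp nyx; apply/commgP; apply: contraT => ncxy.
case: (mulrn_coprime_fmod neq_qp q_pr) => u.
have nWy := subsetP nWG y Gy;
  have sYW : <[y]> \subset 'N(W) by rewrite cycle_subG.
rewrite [#[y]]orderE;
  apply: (@norm_sums_coset _ W abW <[y]>%G x p u p_pr) => //.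
- exact: (subsetP nWG).
- move=> v; apply: norm_sum_fixed => //=; rewrite cent_cycle.
  apply: p'elt_fixpoint_free => //; last by rewrite -order_gt1 prime_gt1.
  by rewrite /p_elt pnatE // !inE.
move=> g xg; have [z yz defg] := lcosetP xg.
have Gz : z \in G by apply: (subsetP _ z yz); rewrite cycle_subG.
have Gg : g \in G by rewrite defg groupM.
have nyg : g \in 'N(<[y]>) by rewrite defg groupM // (subsetP (normG _)).
(* Modulo [<[y]>] the element [g] equals [x], so [g ^+ p] lies in [<[y]>]. If nontrivial it
   generates [<[y]>], so [g], and with it [x], commutes with [y]. *)
have gp : g ^+ p = 1.
  have ygp : g ^+ p \in <[y]>.
    apply: coset_idr; rewrite ?groupX // morphX //.
    have eq_gx : coset <[y]> g = coset <[y]> x.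
      by apply/rcoset_kercosetP; rewrite // norm_rlcoset.
    by rewrite [X in X ^+ _]eq_gx -morphX // odd_p_elt_expg // morph1.
  apply/eqP; apply: contraR ncxy => nt_gp; apply/commgP.
  have ogp : #[g ^+ p] = #[y].
    by apply: nt_prime_order => //; rewrite orderE expg_cardG.
  have defy := cyclic_pair_eq_cycle ogp (mem_cyclic_pair (cycle_cyclic y) ygp
    (cycle_id y)).
  have /cycleP[i defy'] : y \in <[g ^+ p]> by rewrite defy cycle_id.
  have cgy : commute y g by rewrite defy' -expgM; apply/commute_sym/commuteX.
  have czy : commute y z by case/cycleP: yz => i' ->; apply: commuteX.
  rewrite -[x](mulgK z) -defg; apply/commute_sym/commuteM => //.
  exact: commuteV.
split=> // v.
have pg : p.-elt g by rewrite /p_elt (pnat_dvd (_ : _ %| p)) ?pnat_id //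
  order_dvdn gp.
have nWg := subsetP nWG g Gg.
have pgv : p.-elt (g * val v).
  have pL : p.-group (W <*> <[g]>) by rewrite norm_joinEr ?cycle_subG //
    pgroupM pW.
  by apply: mem_p_elt pL _;
    rewrite groupM // mem_gen // inE ?fmodP ?cycle_id ?orbT.
have Ggv : g * val v \in G by rewrite (groupM Gg) // (subsetP sWG) ?fmodP.
(* The [p]-th powers of [g] and [g * val v] are both 1, and they differ by the norm of [v]. *)
apply: val_inj; rewrite -[LHS]mul1g -{1}gp -(expg_mul_fmod v p nWg).
exact: odd_p_elt_expg.
Qed.

Lemma normal_abelem_even_prime : ~~ odd p.
Proof.
apply/negP=> odd_p; case/negP: nsolG.
have oddG := odd_abelem_odd_order odd_p.
apply: (@smallest_prime_solvable p) => [r R r_pr neq_rp sylR | x y Gx Gy px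
  y_pr neq_yp nyx].
  have [sRG rR _] := and3P sylR.
  have [-> | ntR] := eqsVneq R 1; first exact: cyclic1.
  have [_ rdvR _] := pgroup_pdiv rR ntR.
  by apply: odd_p'group_cyclic rR => //;
    apply: dvdn_odd (dvdn_trans rdvR (cardSg sRG)) oddG.
exact: odd_p_elt_cent_prime.
Qed.

End AbelianNormal.

(** * Normal elementary abelian 2-subgroups *)

Section TwoAbelianNormal.

Variables (gT : finGroupType) (G W : {group gT}).
Hypotheses (clawG : no_cyclic_claw G) (nsolG : ~~ solvable G).
Hypotheses (nsWG : W <| G) (ntW : W :!=: 1) (abelW : 2.-abelem W).

Let sWG : W \subset G := normal_sub nsWG.
Let nWG : G \subset 'N(W) := normal_norm nsWG.
Let abW : abelian W := abelem_abelian abelW.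
Let pW : 2.-group W := abelem_pgroup abelW.
Let two_pr : prime 2 := isT.

Let sqW v : v \in W -> v ^+ 2 = 1.
Proof. exact: abelem_expg. Qed.

Let invW v : v \in W -> v^-1 = v.
Proof. by move=> Wv; apply/eqP; rewrite eq_invg_mul -[v * v]/(v ^+ 2) sqW. Qed.

Let WG v : v \in W -> v \in G. Proof. exact: (subsetP sWG). Qed.

Definition involutive_twist t :=
  [&& t \in G, 2.-elt t, t \notin 'C(W) & t ^+ 2 \in 'C(W)].

(** Otherwise repeated square roots show that every 2-element centralizes [W]. Its commutator with
    an element [y] whose cycle it normalizes then lies in ['C_G(W) :&: <[y]>], trivial for [y] of
    odd prime order, and [smallest_prime_solvable] applies. *)
Lemma involutive_twist_exists : exists t, involutive_twist t.
Proof.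
apply/existsP; apply: contraR nsolG => /existsPn ntw.
have cW x : x \in G -> 2.-elt x -> x \in 'C(W).
  move=> Gx px; have [k ox] := p_natP px.
  have: x ^+ (2 ^ k) \in 'C(W) by rewrite -ox expg_order group1.
  elim: k {ox} => [|k IHk] xk; first by rewrite expn0 expg1 in xk.
  apply: IHk; apply: contraR (ntw (x ^+ (2 ^ k))) => ncx.
  by rewrite /involutive_twist groupX // ncx p_eltX //= -expgM -expnSr.
apply: (@smallest_prime_solvable 2) => [r R r_pr neq_r2 /and3P[sRG rR _] | ].
  have odd_r : odd r by case/even_prime: r_pr neq_r2 => [->|].
  exact: (odd_p'group_cyclic clawG nsolG nsWG ntW abelW r_pr neq_r2).
move=> x y Gx Gy px y_pr neq_y2 nyx; apply/commgP.
have nsC : 'C_G(W) <| G by rewrite -{2}(setIidPl nWG) subcent_normal.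
have pC : 2.-group 'C_G(W) by apply: (cent_normal_abelem_pgroup clawG nsolG).
have ti : 'C_G(W) :&: <[y]> = 1.
  by rewrite coprime_TIg // -orderE; apply: pnat_coprime pC _;
    rewrite pnatE // !inE.
have Cx : x \in 'C_G(W) by rewrite inE Gx cW.
apply/eqP/set1P; rewrite -[[set 1]]ti; apply/setIP; split.
  by rewrite commgEl groupM ?groupV ?memJ_norm // (subsetP (normal_norm nsC)).
by rewrite commgEr groupM ?memJ_norm ?groupV ?cycle_id.
Qed.

(** A subgroup of order [r] acts freely on the nontrivial elements of [W]. *)
Lemma odd_prime_dvd_pred r :
  prime r -> r != 2 -> r %| #|G| -> r %| #|W|.-1.
Proof.
move=> r_pr neq_r2 /(Cauchy r_pr)[y Gy oy].
have sYG : <[y]> \subset G by rewrite cycle_subG.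
rewrite -oy orderE regular_norm_dvd_pred ?(subset_trans sYG) // => z
  /setD1P[nt_z yz].
rewrite (p'elt_fixpoint_free clawG nsolG nsWG ntW abelW) ?(subsetP sYG) //.
by apply: mem_p_elt yz; rewrite /pgroup -orderE oy pnatE // !inE.
Qed.

(* If |W| <= 8, then |W| - 1 is 1, 3 or 7, so |G| has at most two prime
   divisors. *)
Lemma card_W_gt8 : 8 < #|W|.
Proof.
rewrite ltnNge; apply: contra nsolG => leW8; apply: Burnside_p_a_q_b.
have [n oW] := p_natP pW.
have [s sP] : exists s, forall r, prime r -> r %| #|W|.-1 -> r = s.
  have: n <= 3 by rewrite -(leq_exp2l _ _ (isT : 1 < 2)) -oW.
  case: n oW => [|[|[|[|]]]] // oW _; rewrite ?oW.
  - by case/eqP: ntW; apply: card1_trivg; rewrite oW.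
  (* For [#|W| = 2] no prime divides [#|W| - 1], so [s] is arbitrary. *)
  - by exists 1%N => r r_pr; rewrite dvdn1 => /eqP r1; rewrite r1 in r_pr.
  - by exists 3 => r r_pr; rewrite dvdn_prime2 // => /eqP.
  by exists 7 => r r_pr; rewrite dvdn_prime2 // => /eqP.
apply: (@uniq_leq_size _ _ [:: 2; s]) => [|r]; first exact: primes_uniq.
rewrite mem_primes => /and3P[r_pr _ rG]; rewrite !inE.
by have [//| neq_r2] := eqVneq r 2; rewrite (sP r) ?odd_prime_dvd_pred ?eqxx.
Qed.

(** If the bound fails, there are [1], [v2], [v3] in distinct cosets of [V :&: <[c]>], and [t],
    [t * v2], [t * v3] are leaves of a claw with centre [c]. *)
Lemma translates_card_bound t c (V : {group gT}) :
    V \subset W -> t \in G -> c \in G -> #[c] = 2 ->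
    {in V, forall v, c \in <[t * v]>} ->
  #|V| <= 2 * #|V :&: <[c]>|.
Proof.
move=> sVW Gt Gc oc tV; rewrite leqNgt; apply/negP=> ltDV.
have [v2 Vv2 nDv2] : exists2 v, v \in V & v \notin V :&: <[c]>.
  apply/subsetPn; apply: contraL ltDV => /subset_leq_card leVD.
  by rewrite -leqNgt (leq_trans leVD) // leq_pmull.
have [v3 Vv3 nDv3] :
    exists2 v, v \in V & v \notin (V :&: <[c]>) :|: (v2 *: (V :&: <[c]>)).
  apply/subsetPn; apply: contraL ltDV => /subset_leq_card leVD.
  rewrite -leqNgt (leq_trans leVD) // cardsU card_lcoset mul2n -addnn.
  exact: leq_subr.
have VW : {in [:: 1; v2; v3], forall v, v \in V}.
  by move=> v; rewrite !inE => /or3P[] /eqP->.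
have inG : {in [:: 1; v2; v3], forall v, t * v \in G /\ c \in <[t * v]>}.
  move=> v /VW Vv; split; last exact: tV.
  by rewrite groupM // WG ?(subsetP sVW).
have exp1 : {in [:: 1; v2; v3] &, forall v w, (v^-1 * w) ^+ #[c] = 1}.
  by move=> v w /VW Vv /VW Vw; rewrite oc sqW // groupM ?groupV ?(subsetP sVW).
have c_pr : prime #[c] by rewrite oc.
have := three_translates_claw clawG Gc c_pr inG exp1.
move: nDv2 nDv3; rewrite !inE mem_lcoset !inE Vv2 Vv3 groupM ?groupV //=.
by rewrite invg1 !mul1g => /negPf-> /norP[/negPf-> /negPf->].
Qed.

(** On the abelian group [W], the map taking [v] to [[~ v, t]] is an endomorphism with kernel
    ['C_W[t]]. *)
Lemma commutator_image_card t : t \in 'N(W) ->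
  (#|[set [~ v, t] | v in W]| * #|'C_W[t]|)%N = #|W|.
Proof.
move=> nWt; pose f v := [~ v, t].
have fW v : v \in W -> f v \in W.
  by move=> Wv; rewrite /f commgEl groupM ?groupV ?memJ_norm.
have fM : {in W &, {morph f : v w / v * w}}.
  move=> v w Wv Ww; rewrite /f commMgJ; congr (_ * _).
  by rewrite conjgE -(centsP abW _ Ww _ (fW v Wv)) mulKg.
pose F := Morphism fM.
have kerF : 'ker F = 'C_W[t].
  apply/setP=> v; have [Wv | nWv] := boolP (v \in W); last first.
    by rewrite !in_setI (negPf nWv).
  apply/(kerP F Wv)/setIP=> [/eqP/commgP cvt | [_ /cent1P/commgP/eqP //]].
  by split=> //; apply/cent1P.
have := card_morphim F W; rewrite morphimEdom setIid kerF => ->.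
by rewrite mulnC Lagrange // subsetIl.
Qed.

Section Twist.

Variable t : gT.
Hypothesis twt : involutive_twist t.

Let Gt : t \in G. Proof. by case/and4P: twt. Qed.
Let pt : 2.-elt t. Proof. by case/and4P: twt. Qed.
Let nct : t \notin 'C(W). Proof. by case/and4P: twt. Qed.
Let ct2 : t ^+ 2 \in 'C(W). Proof. by case/and4P: twt. Qed.
Let nWt : t \in 'N(W). Proof. exact: (subsetP nWG). Qed.

(** In additive form [[~ v, t]] is [v + v ^ t], which [t] fixes because [t ^+ 2] centralizes [W]. *)
Lemma twist_commutator_cent v : v \in W -> [~ v, t] \in 'C_W[t].
Proof.
move=> Wv; rewrite inE commgEl groupM ?groupV ?memJ_norm //=;
  apply/cent1P/commgP.
rewrite -conjg_fix conjMg -conjgM -[t * t]/(t ^+ 2).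
have -> : v ^ (t ^+ 2) = v by apply/conjg_fixP/commgP/esym/(centP ct2).
by rewrite conjVg (invW (_ : v ^ t \in W)) ?memJ_norm // invW // (centsP abW _
  _ _ Wv) ?memJ_norm.
Qed.

Lemma twist_sqr v : v \in W -> (t * v) ^+ 2 = t ^+ 2 * [~ v, t].
Proof.
move=> Wv; have Wvt : v ^ t \in W by rewrite memJ_norm.
rewrite commgEl invW // (centsP abW v Wv _ Wvt) mulgA conjgE.
by rewrite -[(t * v) ^+ 2]/(t * v * (t * v)) -[t ^+ 2]/(t * t) !mulgA mulgK.
Qed.

Let sRC : [set [~ v, t] | v in W] \subset 'C_W[t].
Proof. by apply/subsetP=> _ /imsetP[v Wv ->]; apply: twist_commutator_cent. Qed.

Let card_W_ge16 : 16 <= #|W|.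
Proof.
have [n oW] := p_natP pW; have := card_W_gt8; rewrite oW.
by rewrite -[8]/(2 ^ 3)%N -[16]/(2 ^ 4)%N ltn_exp2l // leq_exp2l.
Qed.

Let card_C_ge4 : 4 <= #|'C_W[t]|.
Proof.
rewrite -leq_sqr (leq_trans card_W_ge16) // -(commutator_image_card nWt).
by rewrite -mulnn leq_mul2r subset_leq_card ?orbT.
Qed.

(** Otherwise [t] has order at least 4, and the involution [c] of [<[t]>] is a power of too many
    translates of [t] for [translates_card_bound]. *)
Lemma twist_sqr_mem : t ^+ 2 \in W.
Proof.
apply: contraT => nWt2.
have [[|[|k]] ot] := p_natP pt.
- by move/eqP: ot; rewrite order_eq1 => /eqP t1; move: nct; rewrite t1 group1.
- by rewrite -[X in t ^+ X](expn1 2) -ot expg_order group1 in nWt2.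
pose c := t ^+ (2 ^ k.+1).
have oc : #[c] = 2.
  by rewrite orderXdiv ot ?dvdn_exp2l // [(2 ^ k.+2)%N]expnS mulnK // expn_gt0.
have Gc : c \in G by rewrite groupX.
have pow_c v : v \in W -> commute (t ^+ 2) v /\ (t * v) ^+ 2 = t ^+ 2 * [~ v,
  t].
  by move=> Wv; split; [apply: (centP ct2) | apply: twist_sqr].
(* For order 4 the translates by ['C_W[t]] are used, and [c = t ^+ 2] is not in [W]. From order 8
   on, all translates by [W] have [c] as a power. *)
case: k ot @c oc Gc => [|k] ot c oc Gc.
  have tcv v : v \in 'C_W[t] -> c \in <[t * v]>.
    case/setIP=> Wv /cent1P/commgP/eqP cvt.
    by rewrite /c -[t ^+ _]mulg1 -cvt -twist_sqr // mem_cycle.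
  have := translates_card_bound (subsetIl _ _) Gt Gc oc tcv.
  rewrite leqNgt (leq_trans _ card_C_ge4) // -[4]/(2 * 2)%N ltn_pmul2l //.
  rewrite ltnS -(cards1 (1 : gT)) subset_leq_card //; apply/subsetP=> v.
  rewrite cycle2g // => /setIP[/setIP[Wv _] /set2P[-> | vc]];
    first exact: set11.
  by rewrite -[t ^+ 2]/c -vc Wv in nWt2.
have tcv v : v \in W -> c \in <[t * v]>.
  move=> Wv; have [_ tv2] := pow_c v Wv.
  have /setIP[WR _] := twist_commutator_cent Wv.
  have [ct2R _] := pow_c _ WR.
  have -> : c = (t * v) ^+ (2 ^ k.+2).
    rewrite expnS [RHS]expgM tv2 expgMn // -expgM -expnS.
    by rewrite [X in _ = _ * _ ^+ X]expnS [[~ v, t] ^+ _]expgM sqW // expg1n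
      mulg1.
  exact: mem_cycle.
have := translates_card_bound (subxx W) Gt Gc oc tcv.
rewrite leqNgt (leq_trans _ card_W_ge16) // -[16]/(2 * 8)%N ltn_pmul2l //.
by rewrite ltnS (leq_trans (subset_leq_card (subsetIr _ _))) // -orderE oc.
Qed.

(** Some [t * v] has a nontrivial square [c] in [W], and multiplying [t * v] by elements of
    ['C_W[t]] keeps that square. *)
Let card_C_le4 : #|'C_W[t]| <= 4.
Proof.
have [v [Wv nt_tv]] : exists v, v \in W /\ (t * v) ^+ 2 != 1.
  have [t2 | nt_t2] := eqVneq (t ^+ 2) 1; last first.
    by exists 1; rewrite group1 mulg1.
  have [v Wv] : exists2 v, v \in W & t \notin 'C[v].
    apply/exists_inP; apply: contraR nct => /exists_inPn cWt.
    by apply/centP=> v /cWt/negbNE/cent1P.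
  move=> nctv; exists v; split=> //; rewrite twist_sqr // t2 mul1g.
  by apply: contra nctv => /commgP cvt; apply/cent1P/commute_sym.
pose c := (t * v) ^+ 2.
have WR := twist_commutator_cent Wv.
have Wc : c \in W by rewrite /c twist_sqr // groupM ?twist_sqr_mem //;
  case/setIP: WR.
have oc : #[c] = 2 by apply: nt_prime_order => //; apply: sqW.
have Gtv : t * v \in G by rewrite groupM // WG.
have tcv u : u \in 'C_W[t] -> c \in <[t * v * u]>.
  case/setIP=> Wu /cent1P cut.
  have cuv : commute (t * v) u.
    by apply/commute_sym/commuteM => //; apply: (centsP abW).
  suffices -> : c = (t * v * u) ^+ 2 by apply: mem_cycle.
  by rewrite expgMn // (sqW Wu) mulg1.
have := translates_card_bound (subsetIl _ _) Gtv (WG Wc) oc tcv.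
move/leq_trans; apply; rewrite -[4]/(2 * 2)%N leq_pmul2l //.
by rewrite (leq_trans (subset_leq_card (subsetIr _ _))) // -orderE oc.
Qed.

Lemma twist_card_cent : #|'C_W[t]| = 4.
Proof. by apply/eqP; rewrite eqn_leq card_C_le4 card_C_ge4. Qed.

(** The inclusion is an equality because the two cardinals multiply to at least 16 and the
    centralizer has order 4. *)
Lemma twist_commutators : [set [~ v, t] | v in W] = 'C_W[t].
Proof.
apply/eqP; rewrite eqEcard sRC twist_card_cent.
rewrite -(leq_pmul2r (cardG_gt0 'C_W[t])) commutator_image_card //
  twist_card_cent.
exact: card_W_ge16.
Qed.

(** By [twist_commutators], [t ^- 2 * w] is a commutator [[~ v1, t]], which makes [w] the square of
    [t * v1]. For [v2], multiply [v1] by an element of ['C_W[t]] outside [<[w]>]. *)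
Lemma twist_square_roots w : w \in 'C_W[t] -> w != 1 ->
  exists v1 v2, [/\ v1 \in W, v2 \in W, (t * v1) ^+ 2 = w, (t * v2) ^+ 2 = w
                  & ~~ cyclic_pair (t * v1) (t * v2)].
Proof.
move=> Cw nt_w; have [Ww cwt] := setIP Cw.
have ow : #[w] = 2 by apply: nt_prime_order => //; apply: sqW.
have : t ^- 2 * w \in 'C_W[t].
  rewrite groupM // groupV inE twist_sqr_mem; apply/cent1P.
  exact/commute_sym/commuteX.
rewrite -twist_commutators => /imsetP[v1 Wv1 def_v1].
have [d /setIP[Wd cdt] nwd] : exists2 d, d \in 'C_W[t] & d \notin <[w]>.
  apply/subsetPn; apply: contraL (leqnn 4) => /subset_leq_card.
  by rewrite twist_card_cent -orderE ow.
have sq1 : (t * v1) ^+ 2 = w by rewrite twist_sqr // -def_v1 mulKVg.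
have cd : commute (t * v1) d.
  apply/commute_sym/commuteM; first exact/cent1P.
  exact: (centsP abW).
exists v1, (v1 * d); rewrite groupM // mulgA; split=> //.
  by rewrite expgMn // (sqW Wd) sq1 mulg1.
apply: contra nwd; have w_pr : prime #[w] by rewrite ow.
have w1 : w \in <[t * v1]> by rewrite -sq1 mem_cycle.
by move/(cyclic_pair_mem_cycle w_pr w1); rewrite mulKg ow; apply; apply: sqW.
Qed.

End Twist.

(* Otherwise w has square roots in both tW and sW, two pairwise noncyclic ones
   in each, and three of them form a claw with centre w. *)
Lemma twist_unique t s w : involutive_twist t -> involutive_twist s ->
  w \in 'C_W[t] -> w \in 'C_W[s] -> w != 1 -> t^-1 * s \in 'C(W).
Proof.
move=> twt tws Ct Cs nt_w; have [Ww _] := setIP Ct.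
have [v1 [v2 [Wv1 Wv2 sq1 sq2 nc12]]] := twist_square_roots twt Ct nt_w.
have [u [_ [Wu _ squ _ _]]] := twist_square_roots tws Cs nt_w.
have Gt : t \in G by case/and4P: twt.
have Gs : s \in G by case/and4P: tws.
have ow : #[w] = 2 := nt_prime_order two_pr (sqW Ww) nt_w.
have w_pr : prime #[w] by rewrite ow.
have sqP g : g ^+ 2 = w -> cyclic_pair w g.
  by move=> gw; rewrite cyclic_pairC cyclic_pair_cycle // -gw mem_cycle.
have main v : v \in W -> (t * v) ^+ 2 = w -> cyclic_pair (t * v) (s * u) ->
    t^-1 * s \in 'C(W).
  move=> Wv sqv cp; have cvu : commute (t * v) (s * u).
    case/cyclic_pairP: cp => z _ /andP[/cycleP[i ->] /cycleP[j ->]].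
    exact/commuteX2.
  (* The two elements commute and both square to [w], so their quotient squares to 1 and lies in
     [<[w]>]. *)
  have: (t * v)^-1 * (s * u) \in W.
    have w_v : w \in <[t * v]> by rewrite -sqv mem_cycle.
    apply: (subsetP _ _ (cyclic_pair_mem_cycle w_pr w_v _ cp));
      first by rewrite cycle_subG.
    rewrite ow expgMn; last exact/commute_sym/commuteV/commute_sym.
    by rewrite expgVn sqv squ mulVg.
  rewrite invMg !mulgA => Wvtsu.
  have: v^-1 * t^-1 * s * u \in 'C(W) := subsetP abW _ Wvtsu.
  have cWv : v \in 'C(W) := subsetP abW _ Wv; have cWu := subsetP abW _ Wu.
  by rewrite groupMr // -mulgA groupMl ?groupV.
have Gw : w \in G^# by rewrite !inE nt_w WG.
have [Gv1 Gv2 Gu] : [/\ t * v1 \in G, t * v2 \in G & s * u \in G].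
  by rewrite !groupM // WG.
case/or3P: (clawG Gw Gv1 Gv2 Gu (sqP _ sq1) (sqP _ sq2) (sqP _ squ)).
- by rewrite (negPf nc12).
- exact: main.
exact: main.
Qed.

(* For a fixed point w of P and A = C_W(t), |A| = 4, uniqueness of t modulo
   C_G(W) makes P act on A, with C_P(A) generated by t modulo C_G(W); as P fixes
   w it acts on A through a group of order at most 2. *)
Lemma Sylow2_quotient_cyclic (S : {group gT}) :
  2.-Sylow(G) S -> cyclic (S / 'C_G(W)).
Proof.
pose C := 'C_G(W)%G; move=> sylS.
have nsC : C <| G by rewrite /C /= -{2}(setIidPl nWG) subcent_normal.
suffices [P' sylP' cycP'] : exists2 P' : {group gT}, 2.-Sylow(G) P' & cyclic
  (P' / C).
  have [g Gg ->] := Sylow_trans sylP' sylS.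
  by rewrite quotientJ ?(subsetP (normal_norm nsC)) // cyclicJ.
have [t twt] := involutive_twist_exists.
have [Gt pt nct ct2] := and4P twt.
have st_G : <[t]> \subset G by rewrite cycle_subG.
have [P sylP st_P] := Sylow_superset st_G pt.
have Pt : t \in P by rewrite -cycle_subG.
exists P => //; have [sPG pP _] := and3P sylP.
have PG g : g \in P -> g \in G := fun Pg => subsetP sPG g Pg.
have sWP : W \subset P.
  by apply: subset_trans (pcore_sub_Hall sylP); apply: pcore_max.
have nsWP : W <| P by rewrite /normal sWP (subset_trans sPG).
have [w /setIP[Ww /centerP[_ cwP]] nt_w] := trivgPn _ (meet_center_nil
  (pgroup_nil pP) nsWP ntW).
have nWP g v : g \in P -> v \in W -> v ^ g \in W.
  by move=> Pg Wv; rewrite memJ_norm // (subsetP nWG) ?PG.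
have twist_eq s : s \in P -> s \notin 'C(W) -> s ^+ 2 \in 'C(W) -> t^-1 * s \in
  'C(W).
  move=> Ps ncs cs2; apply: (@twist_unique t s w) => //.
  - by rewrite /involutive_twist PG // ncs cs2 (mem_p_elt pP).
  - by rewrite inE Ww; apply/cent1P/cwP.
  by rewrite inE Ww; apply/cent1P/cwP.
pose A := 'C_W[t]%G.
have sAW : A \subset W := subsetIl _ _.
have Aw : w \in A by rewrite inE Ww; apply/cent1P/cwP.
(* A conjugate of [t] under [P] is again a twist fixing [w], so it agrees with [t] modulo
   ['C(W)]. *)
have twJ g : g \in P -> t^-1 * t ^ g \in 'C(W).
  move=> Pg; have nCWg : g \in 'N('C(W)) by rewrite (subsetP (norms_cent nWG))
    ?PG.
  by apply: twist_eq;
    [apply: groupJ | rewrite memJ_norm | rewrite -conjXg memJ_norm].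
have fixC z u : z \in 'C(W) -> u \in W -> u ^ z = u.
  by move=> cWz Wu; apply/conjg_fixP/commgP/esym/(centP cWz).
have nA g v : g \in P -> v \in A -> v ^ g \in A.
  move=> Pg Av; have [Wv /cent1P cvt] := setIP Av.
  have Wvg := nWP g v Pg Wv; rewrite inE Wvg; apply/cent1P.
  apply/commgP; rewrite -conjg_fix; apply/eqP.
  have -> : t = t ^ g * (t^-1 * t ^ g)^-1 by rewrite invMg invgK mulgA mulgV
    mul1g.
  rewrite conjgM -conjJg [v ^ t]conjgE cvt mulKg.
  by rewrite (fixC (t^-1 * t ^ g)^-1 (v ^ g)) ?groupV ?twJ.
(* Since [k] and [t] commute modulo ['C(W)], the commutator [u = [~ v, k]] is fixed by [t]. So [u]
   lies in [A] and is fixed by [k], whence [k ^+ 2] sends [v] to [v * u * u = v]. *)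
have sqC k : k \in P -> k \in 'C(A) -> k ^+ 2 \in 'C(W).
  move=> Pk cAk; apply/centP=> v Wv.
  pose u := [~ v, k].
  have Wvk := nWP k v Pk Wv.
  have Wu : u \in W by rewrite /u commgEl groupM ?groupV.
  pose r := [~ v, t].
  have Ar : r \in A by apply: (twist_commutator_cent twt).
  have vt : v ^ t = v * r by rewrite /r commgEl mulKVg.
  have vkt : v ^ (k * t) = v ^ k * r.
    have := twJ k^-1; rewrite groupV => /(_ Pk) cz.
    have -> : k * t = t * (t^-1 * t ^ k^-1) * k.
      by rewrite conjgE invgK mulKVg mulgA mulgKV.
    have Wr := subsetP sAW r Ar.
    rewrite conjgM [v ^ (t * _)]conjgM vt (fixC _ _ cz (groupM Wv Wr)) conjMg.
    by congr (_ * _); apply/conjg_fixP/commgP/esym/(centP cAk).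
  have Au : u \in A.
    rewrite inE Wu; apply/cent1P/commgP;
      rewrite -conjg_fix /u commgEl conjMg conjVg.
    have Wr := subsetP sAW r Ar.
    rewrite vt -conjgM vkt invMg (centsP abW _ Wvk r Wr).
    by rewrite (centsP abW r^-1 _ v^-1) ?groupV // -mulgA mulKg.
  have uk : u ^ k = u by apply/conjg_fixP/commgP/esym/(centP cAk).
  apply/esym/commgP; rewrite -conjg_fix -[k ^+ 2]/(k * k) conjgM.
  have vk : v ^ k = v * u by rewrite /u commgEl mulKVg.
  by rewrite vk conjMg uk vk -mulgA -[u * u]/(u ^+ 2) sqW ?mulg1.
have NC g : g \in P -> g \in 'N(C) by move/PG;
  apply: (subsetP (normal_norm nsC)).
have cosetC k : k \in P -> k \in 'C(A) -> k \notin 'C(W) -> coset C k = coset C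
  t.
  move=> Pk cAk nck.
  have Cu : t^-1 * k \in C by rewrite inE groupM ?groupV ?PG // twist_eq ?sqC.
  rewrite -[k](mulKVg t) morphM ?NC ?groupM ?groupV //=.
  by rewrite (coset_id Cu) mulg1.
have genC k : k \in P -> k \in 'C(A) -> coset C k \in <[coset C t]>.
  move=> Pk cAk; have [ck | nck] := boolP (k \in 'C(W)).
    by rewrite coset_id ?group1 // inE PG.
  by rewrite cosetC ?cycle_id.
have gen g : {in P, forall h, coset C h \in <[coset C g]>} -> cyclic (P / C).
  move=> gP; apply: cyclicS (cycle_cyclic (coset C g)).
  by apply/subsetP=> _ /morphimP[h _ Ph ->]; apply: gP.
have [cAP | /subsetPn[g Pg ncg]] := boolP (P \subset 'C(A)).
  by apply: (gen t) => h Ph; rewrite genC ?(subsetP cAP).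
have [a Aa nag] : exists2 a, a \in A & a ^ g != a.
  apply/exists_inP; apply: contraR ncg => /exists_inPn cga.
  by apply/centP=> v /cga/negbNE; rewrite conjg_fix => /commgP/commute_sym.
have [Wa _] := setIP Aa.
have wP h : h \in P -> w ^ h = w.
  by move=> Ph; apply/conjg_fixP/commgP/cwP.
have nt_a : a != 1 by apply: contraNneq nag => ->; rewrite conj1g.
have naw : a != w by apply: contraNneq nag => ->; rewrite wP.
have defA : A :=: [set v in [:: 1; w; a; a * w]].
  apply/esym/eqP; rewrite eqEcard (twist_card_cent twt) cardsE (card_uniqP _).
    rewrite andbT; apply/subsetP=> v; rewrite inE => Lv.
    have: [|| v == 1, v == w, v == a | v == a * w] by rewrite !inE in Lv.
    by case/or4P=> /eqP->; rewrite ?group1 ?groupM.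
  rewrite /= !inE !negb_or !andbT ![1 == _]eq_sym nt_w nt_a [w == a]eq_sym naw
    /=.
  rewrite -eq_invg_mul (invW Wa) naw /= -{1}[w]mul1g (inj_eq (mulIg w)) eq_sym
    nt_a.
  by rewrite -{1}[a]mulg1 (inj_eq (mulgI a)) eq_sym.
have aP h : h \in P -> a ^ h = a \/ a ^ h = a * w.
  move=> Ph; have: a ^ h \in A := nA h a Ph Aa; rewrite defA inE => Lv.
  have: [|| a ^ h == 1, a ^ h == w, a ^ h == a | a ^ h == a * w] by rewrite
    !inE in Lv.
  rewrite conjg_eq1 (negPf nt_a) -{1}(wP h Ph) (inj_eq (conjg_inj h)) (negPf
    naw) /=.
  by case/orP=> /eqP; [left | right].
have cA h : h \in P -> a ^ h = a -> h \in 'C(A).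
  move=> Ph ah; apply/centP=> v Av; apply/commute_sym/commgP;
    rewrite -conjg_fix.
  have: [|| v == 1, v == w, v == a | v == a * w] by rewrite defA !inE in Av.
  by case/or4P=> /eqP->; rewrite ?conjMg ?conj1g ?wP ?ah.
have ag : a ^ g = a * w by case: (aP g Pg) => // /eqP; rewrite (negPf nag).
have aww : a * w * w = a by rewrite -mulgA -[w * w]/(w ^+ 2) sqW ?mulg1.
have sCA : 'C(W) \subset 'C(A) := centS sAW.
have tA : t \in 'C(A).
  by apply/centP=> v /setIP[_ /cent1P/commute_sym].
(* Otherwise [g] lies in ['C(W)] or agrees with [t] modulo it, and both centralize [A]. *)
have ncg2 : g ^+ 2 \notin 'C(W).
  apply: contra ncg => cg2; have [cg | ncgW] := boolP (g \in 'C(W)).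
    exact: (subsetP sCA).
  by rewrite -[g](mulKVg t) groupM // (subsetP sCA) ?twist_eq.
(* As [g ^+ 2] centralizes [A] but not [W], its coset is that of [t]; hence the coset of [g]
   generates [P / C]. *)
have tg : coset C t \in <[coset C g]>.
  rewrite -(cosetC (g ^+ 2) (groupX 2 Pg)) //;
    first by rewrite morphX ?NC //= mem_cycle.
  apply: cA; first exact: groupX.
  by rewrite -[g ^+ 2]/(g * g) conjgM ag conjMg ag wP.
have tgS : <[coset C t]> \subset <[coset C g]> by rewrite cycle_subG.
apply: (gen g) => h Ph; case: (aP h Ph) => ah.
  by apply: (subsetP tgS); rewrite genC ?cA.
have Phg : h * g^-1 \in P by rewrite groupM ?groupV.
rewrite -[h](mulgKV g) morphM ?NC //= groupM ?cycle_id //.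
apply: (subsetP tgS); apply: genC => //; apply: cA => //.
by rewrite conjgM ah -ag conjgK.
Qed.

Lemma no_normal_2abelem : False.
Proof.
case/negP: nsolG; pose C := 'C_G(W)%G.
have nsC : C <| G by rewrite /C /= -{2}(setIidPl nWG) subcent_normal.
rewrite (series_sol nsC) (cent_normal_abelem_sol clawG nsWG ntW) /=.
(* With [p = 0] no prime is exempt from the Sylow condition, and a 0-element is trivial. *)
apply: (@smallest_prime_solvable 0) => [r R r_pr _ sylR | x y _ _ x0 _ _ _].
  have [S sylS] := Sylow_exists r G; have [sSG rS _] := and3P sylS.
  have sylSC : r.-Sylow(G / C) (S / C).
    by apply: quotient_pHall sylS; apply: subset_trans (normal_norm nsC).
  have [g _ ->] := Sylow_trans sylSC sylR; rewrite cyclicJ.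
  have [r2 | neq_r2] := eqVneq r 2; first by rewrite r2 in sylS;
    apply: Sylow2_quotient_cyclic.
  have odd_r : odd r by case/even_prime: r_pr neq_r2 => [->|].
  exact/quotient_cyclic/(odd_p'group_cyclic clawG nsolG nsWG ntW abelW r_pr).
suffices -> : x = 1 by apply/commute_sym/commute1.
apply/eqP; rewrite -order_eq1; apply/negPn/negP;
  rewrite neq_ltn ltnNge order_gt0 /=.
move=> /pdiv_prime pr; have := pnat_dvd (pdiv_dvd _) x0; rewrite pnatE //.
by rewrite !inE => /eqP p0; rewrite p0 in pr.
Qed.

End TwoAbelianNormal.

(** * Passage to the quotient by the cyclicizer *)

Section Cyclicizer.

Variables (gT : finGroupType) (G : {group gT}).

Lemma mem_cyclicizer_pair x y :
  x \in cyclicizer G -> y \in G -> cyclic_pair x y.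
Proof. by rewrite inE => /andP[_ /forall_inP]; apply. Qed.

(** Lifts have the form [t ^+ i * z1] and [t ^+ j * z2] with [z1], [z2] in the cyclicizer; adjoining
    first [z1], then [z2], to a cyclic group containing [t] keeps it cyclic. *)
Lemma cyclicizer_pair_quotient x y : x \in G -> y \in G ->
  cyclic_pair (coset (cyclicizer G) x) (coset (cyclicizer G) y) = cyclic_pair x
    y.
Proof.
set Z := cyclicizer G => Gx Gy; have nZG := normal_norm (cyclicizer_normal G).
have NZ z : z \in G -> z \in 'N(Z) := fun Gz => subsetP nZG z Gz.
apply/idP/idP => [|cxy]; last first.
  by apply: (mem_cyclic_pair (quotient_cyclic _ cxy));
    rewrite mem_quotient // mem_gen // !inE eqxx ?orbT.
case/cyclic_pairP=> tZ tZin.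
have : tZ \in G / Z.
  by apply: (subsetP _ tZ tZin);
    rewrite gen_subG subUset !sub1set !mem_quotient.
case/morphimP=> t Nt Gt -> /andP[xt yt].
have lift v : v \in G -> coset Z v \in <[coset Z t]> -> exists i z, z \in Z /\
  v = t ^+ i * z.
  move=> Gv /cycleP[i eq_vt]; exists i, (t ^- i * v); rewrite mulKVg;
    split=> //.
  apply: coset_idr; first by rewrite groupM ?groupV ?groupX ?NZ.
  by rewrite morphM ?groupV ?groupX ?NZ // morphV ?groupX // morphX //= -eq_vt
    mulVg.
have [i [z1 [Zz1 ->]]] := lift x Gx xt.
have [j [z2 [Zz2 ->]]] := lift y Gy yt.
have sZG : Z \subset G := normal_sub (cyclicizer_normal G).
have in_gen (a b : gT) : a \in G -> b \in G -> {subset <<[set a; b]>> <= G}.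
  by move=> Ga Gb; apply/subsetP; rewrite gen_subG subUset !sub1set Ga.
have /cyclic_pairP[s gs /andP[z1s ts]] := mem_cyclicizer_pair Zz1 Gt.
have Gs : s \in G := in_gen _ _ (subsetP sZG _ Zz1) Gt _ gs.
have /cyclic_pairP[r gr /andP[z2r sr]] := mem_cyclicizer_pair Zz2 Gs.
have ssr : <[s]> \subset <[r]> by rewrite cycle_subG.
have tr := subsetP ssr t ts; have z1r := subsetP ssr z1 z1s.
by apply: (mem_cyclic_pair (cycle_cyclic r)); rewrite groupM ?groupX.
Qed.

Lemma proper_claw_free_no_cyclic_claw :
  proper_enhanced_claw_free G -> no_cyclic_claw (G / cyclicizer G).
Proof.
move=> clawG uZ aZ bZ cZ /setD1P[nt_u /morphimP[u Nu Gu def_u]].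
case/morphimP=> a Na Ga ->; case/morphimP=> b Nb Gb ->;
  case/morphimP=> c Nc Gc ->.
rewrite {uZ}def_u in nt_u *; rewrite !cyclicizer_pair_quotient // => ua ub uc.
apply: contraT => /norP[nab /norP[nac nbc]]; case: clawG.
have nZu : u \notin cyclicizer G by apply: contra nt_u => Zu;
  rewrite /= coset_id.
have notZ v w : w \in G -> ~~ cyclic_pair v w -> v \notin cyclicizer G.
  by move=> Gw; apply: contra => Zv; apply: mem_cyclicizer_pair.
have neq v w : ~~ cyclic_pair v w -> v != w.
  by apply: contraNneq => ->; rewrite cyclic_pair_cycle ?cycle_id.
have adjE v w : enhanced_adj v w = (v != w) && cyclic_pair v w by [].
have adjC v w : enhanced_adj v w = enhanced_adj w v.
  by rewrite !adjE eq_sym cyclic_pairC.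
have adj_irr v w : ~~ cyclic_pair v w -> enhanced_adj v w = false.
  by move=> nvw; rewrite adjE (negPf nvw) andbF.
have nua : u != a by apply: contraNneq nab => <-.
have nub : u != b by apply: contraNneq nbc => <-.
have nuc : u != c by apply: contraNneq nac => <-; rewrite cyclic_pairC.
(* The left vertex is the centre; the default [u] of [nth] is never reached, as [i < 3]. *)
pose f (v : 'I_1 + 'I_3) := if v is inr i then nth u [:: a; b; c] i else u.
have I3P (P : 'I_3 -> Prop) :
    (forall lt0, P (@Ordinal 3 0 lt0)) -> (forall lt1, P (@Ordinal 3 1 lt1)) ->
    (forall lt2, P (@Ordinal 3 2 lt2)) -> forall i, P i.
  by move=> P0 P1 P2 [[|[|[|m]]] lti].
exists f; split.
- move=> [i | i] [j | j]; first by rewrite (ord1 i) (ord1 j).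
  + by elim/I3P: j => ltj /= /eqP;
    rewrite ?(negPf nua) ?(negPf nub) ?(negPf nuc).
  + by elim/I3P: i => lti /= /esym/eqP;
    rewrite ?(negPf nua) ?(negPf nub) ?(negPf nuc).
  elim/I3P: i => lti; elim/I3P: j => ltj /=; try by move=> _; congr (inr _);
    apply: val_inj.
  + by move/eqP; rewrite (negPf (neq _ _ _ nab)).
  + by move/eqP; rewrite (negPf (neq _ _ _ nac)).
  + by move/esym/eqP; rewrite (negPf (neq _ _ _ nab)).
  + by move/eqP; rewrite (negPf (neq _ _ _ nbc)).
  + by move/esym/eqP; rewrite (negPf (neq _ _ _ nac)).
  by move/esym/eqP; rewrite (negPf (neq _ _ _ nbc)).
(* Dominating vertices form the cyclicizer: [u] avoids it since its coset is nontrivial, and each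
   leaf since it is not joined to another leaf. *)
- move=> v; rewrite /proper_vertices -cyclicizerE inE.
  case: v => [i | i] /=; first by rewrite nZu.
  elim/I3P: i => lti /=; rewrite ?Ga ?Gb ?Gc andbT.
  + exact: notZ nab.
  + exact: notZ nbc.
  by apply: (notZ c a) => //; rewrite cyclic_pairC.
have adj_u v : cyclic_pair u v -> u != v -> enhanced_adj u v by rewrite adjE =>
  -> ->.
move=> [i | i] [j | j] /=.
- by rewrite adjE eqxx.
- by elim/I3P: j => ltj /=; rewrite adj_u.
- by rewrite adjC; elim/I3P: i => lti /=; rewrite adj_u.
elim/I3P: i => lti; elim/I3P: j => ltj /=;
  first [exact: adj_irr | by rewrite adjE eqxx | by rewrite adjC adj_irr].
Qed.

End Cyclicizer.

Theorem theorem5p4 (gT : finGroupType) (G : {group gT}) :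
  ~~ solvable G ->
  proper_enhanced_claw_free G ->
  almost_simple (G / cyclicizer G).
Proof.
move=> nsolG /proper_claw_free_no_cyclic_claw clawQ.
set Q := (G / cyclicizer G)%G in clawQ *.
(* The cyclicizer is central, hence solvable. *)
have nsolQ : ~~ solvable Q.
  apply: contra nsolG => solQ;
    rewrite (series_sol (cyclicizer_normal G)) solQ andbT.
  by rewrite (solvableS (cyclicizer_sub_center G)) // abelian_sol //
    center_abelian.
have ntQ : Q :!=: 1 by apply: contraNneq nsolQ => ->; apply: solvable1.
have [N minN sNQ] := minnormal_exists ntQ (normG Q).
apply: (minnormal_nonabelian_almost_simple clawQ minN sNQ).
apply/negP=> abN.
have [nNQ ntN /is_abelemP[p p_pr abelN]] := minnormal_solvable minN (subxx N)
  (abelian_sol abN).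
have nsNQ : N <| Q by rewrite /normal sNQ.
have := normal_abelem_even_prime clawQ nsolQ p_pr nsNQ ntN abelN.
case/even_prime: p_pr => [p2 _ | -> //]; rewrite p2 in abelN.
exact: (no_normal_2abelem clawQ nsolQ nsNQ ntN abelN).
Qed.
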